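(* Let $H=\langle n_1,n_2,n_3,n_4\rangle$ be an almost symmetric numerical semigroup minimally generated by $4$ elements, of type $t$, and let $N=n_1+n_2+n_3+n_4$. Let $$0\to \bigoplus_{f\in \mathrm{PF}(H)}S(-f-N)\to \bigoplus_{i=1}^{m+t-1}S(-b_i)\to \bigoplus_{i=1}^mS(-a_i)\to S\to K[H]\to0$$ be the graded minimal free resolution of $K[H]$ over $S$, so that $m$ is the minimal number of generators of $I_H$. Put $m_0=3(t-1)$. Then $m=m_0+s$ with $s\geq 0$, and the numbers $a_1,\dots,a_m$ and $b_1,\dots,b_{m+t-1}$ can be ordered in such a way that one has the following equalities of multisets: $$\{a_1,\ldots,a_{m_0}\}\cup\{\mathrm F(H)+N-a_1,\ldots,\mathrm F(H)+N-a_{m_0}\}=\{f+n_i+n_j : f\in\mathrm{PF}'(H),\ 1\le i<j\le 4\},$$ $$\{b_1,\ldots,b_{m_0+t-1}\}=\{f+N-n_i : f\in\mathrm{PF}'(H),\ 1\le i\le 4\},$$ and, if $s>0$, $$a_{m_0+j}=\mathrm F(H)+N-b_{m_0+t-1+j}\qquad(1\le j\le s).$$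
   Context: A numerical semigroup is a submonoid $H\subset\mathbb N$ with $0\in H$ and $\mathbb N\setminus H$ finite; we assume $H\ne\mathbb N$. $\mathrm F(H)=\max(\mathbb N\setminus H)$; $\mathrm{PF}(H)=\{f\in\mathbb Z\setminus H : f+n_i\in H\text{ for all }i\}$; $\mathrm{PF}'(H)=\mathrm{PF}(H)\setminus\{\mathrm F(H)\}$; the type of $H$ is $|\mathrm{PF}(H)|$; $H$ is almost symmetric if $2|\mathbb N\setminus H|=\mathrm F(H)+|\mathrm{PF}(H)|$. $K$ is a field, $S=K[x_1,x_2,x_3,x_4]$ is graded by $\deg x_i=n_i$, $K[H]=K[t^{n_1},\dots,t^{n_4}]\cong S/I_H$, where $I_H$ is the kernel of $S\to K[t]$, $x_i\mapsto t^{n_i}$. *)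

(* Defs.v *)
From mathcomp Require Export all_boot all_order all_algebra.
From mathcomp Require Export finmap.
From mathcomp.multinomials Require Export mpoly.

Set Implicit Arguments.
Unset Strict Implicit.
Unset Printing Implicit Defensive.

Import Order.TTheory GRing.Theory Num.Theory.

Local Open Scope ring_scope.

(* A numerical semigroup is given by its finite complement in nat. *)
Record numSemigroup := NumSemigroup {
  gaps : {fset nat};
  _ : 0%N \notin gaps;
  _ : forall x y : nat, x \notin gaps -> y \notin gaps -> (x + y)%N \notin gaps
}.

Definition in_semigroup (H : numSemigroup) : {pred nat} :=
  fun x => x \notin gaps H.

Coercion in_semigroup : numSemigroup >-> pred_sort.

(* Membership in H of an integer, H being seen as a subset of the integers. *)
Definition int_in (H : numSemigroup) (z : int) : bool :=
  if z is Posz k then k \in H else false.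

(* F(H) = max (nat \ H); the value 0 for H = nat is irrelevant. *)
Definition frobenius (H : numSemigroup) : nat := \max_(x <- gaps H) x.

Definition gen_by (n : 'I_4 -> nat) (A : {set 'I_4}) (x : nat) : Prop :=
  exists c : 'I_4 -> nat, x = (\sum_(i in A) c i * n i)%N.

Definition minimally_generated (H : numSemigroup) (n : 'I_4 -> nat) : Prop :=
  (forall x, x \in H <-> gen_by n [set: 'I_4] x) /\
  (forall A : {set 'I_4}, A \proper [set: 'I_4] ->
     ~ (forall x, x \in H <-> gen_by n A x)).

Definition pseudo_frobenius (H : numSemigroup) (n : 'I_4 -> nat) (f : int) :=
  ~~ int_in H f && [forall i, int_in H (f + (n i)%:Z)].

(* The sequence lists all the gaps of H and the integers -1, ..., -n_1: every
   f outside H with f + n_1 in H is among them, see mem_PF. *)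
Definition PF (H : numSemigroup) (n : 'I_4 -> nat) : {fset int} :=
  [fset f in [seq x%:Z | x <- enum_fset (gaps H)] ++
             [seq Negz j | j <- iota 0 (n ord0)]
   | pseudo_frobenius H n f]%fset.

Lemma mem_PF (H : numSemigroup) (n : 'I_4 -> nat) (f : int) :
  (f \in PF H n) = pseudo_frobenius H n f.
Proof.
rewrite !inE /=; case: (boolP (pseudo_frobenius H n f)); rewrite ?andbF //.
case/andP=> fH /forallP /(_ ord0) fn; rewrite andbT mem_cat.
case: f fH fn => [k|k] /=.
  move=> kH _; apply/orP; left; apply/mapP; exists k => //.
  by move: kH; rewrite unfold_in negbK.
move=> _ kn; apply/orP; right; apply/mapP; exists k => //.
rewrite mem_iota add0n /=; apply: contraTT kn; rewrite -leqNgt => nk.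
have -> : Negz k + (n ord0)%:Z = Negz (k - n ord0); last by [].
by rewrite !NegzE -subSn // -subzn ?leqW // opprB addrC.
Qed.

Definition PF' (H : numSemigroup) (n : 'I_4 -> nat) : {fset int} :=
  (PF H n `\ (frobenius H)%:Z)%fset.

Definition sg_type (H : numSemigroup) (n : 'I_4 -> nat) : nat := #|` PF H n|%fset.

Definition almost_symmetric (H : numSemigroup) (n : 'I_4 -> nat) : Prop :=
  (2 * #|` gaps H|%fset = frobenius H + sg_type H n)%N.

Section Resolutions.

Variables (K : fieldType) (n : 'I_4 -> nat).

Local Notation S := {mpoly K[4]}.

Definition wdeg (u : 'X_{1..4}) : nat := (\sum_(i < 4) u i * n i)%N.

(* Homogeneity of integer degree d for deg x_i = n_i; if d < 0, only 0 is. *)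
Definition homogeneous (d : int) (p : S) : Prop :=
  forall u, u \in msupp p -> (wdeg u)%:Z = d.

(* The K-algebra map S -> K[t], x_i |-> t^(n_i); its image is K[H] and its
   kernel is I_H. *)
Definition toric_map (p : S) : {poly K} :=
  mmap (@polyC K) (fun i => 'X^(n i)) p.

(* Free modules consist of row vectors and a matrix A is the map v |-> v *m A.
   A is homogeneous of degree 0 from (+)_i S(-b_i) to (+)_j S(-a_j), where S(-a)
   has its generator in degree a. *)
Definition graded_map q m (b : q.-tuple int) (a : m.-tuple int)
    (A : 'M[S]_(q, m)) : Prop :=
  forall i j, homogeneous (tnth b i - tnth a j) (A i j).

(* The image of A lies in (x_1, ..., x_4) times the target. *)
Definition minimal_map q m (A : 'M[S]_(q, m)) : Prop :=
  forall i j, (A i j)@_0%MM = 0.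

Definition exact_at q m r (A : 'M[S]_(q, m)) (B : 'M[S]_(m, r)) : Prop :=
  forall v : 'rV[S]_m, v *m B = 0 <-> exists u : 'rV[S]_q, v = u *m A.

(* 0 -> (+)S(-c_k) -d3-> (+)S(-b_j) -d2-> (+)S(-a_i) -d1-> S -> K[H] -> 0 *)
Record graded_min_free_res p q m
    (c : p.-tuple int) (b : q.-tuple int) (a : m.-tuple int)
    (d3 : 'M[S]_(p, q)) (d2 : 'M[S]_(q, m)) (d1 : 'M[S]_(m, 1)) : Prop := {
  gr3 : graded_map c b d3;
  gr2 : graded_map b a d2;
  gr1 : graded_map a [tuple 0] d1;
  min3 : minimal_map d3;
  min2 : minimal_map d2;
  min1 : minimal_map d1;
  inj3 : forall u : 'rV[S]_p, u *m d3 = 0 -> u = 0;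
  exact2 : exact_at d3 d2;
  exact1 : exact_at d2 d1;
  exact0 : forall v : S,
    toric_map v = 0 <-> exists u : 'rV[S]_m, v = (u *m d1) 0 0
}.

End Resolutions.

(* Main.v *)
Require Import Defs.
From HB Require Import structures.
From mathcomp Require Import zify ring.
From mathcomp.multinomials Require Import ssrcomplements.

Set Implicit Arguments.
Unset Strict Implicit.
Unset Printing Implicit Defensive.

Import Order.TTheory GRing.Theory Num.Theory.

Local Open Scope ring_scope.

(* For an integer d let Delta_d be the simplicial complex on four vertices whose
   faces are the sets A with d - sum_(i in A) n_i in H.  The number of a_i equal
   to d is one less than the number of connected components of Delta_d, and
   counting dimensions along the resolution then expresses the number of b_j
   equal to d by this number, by the last (given) shifts and by the Euler
   characteristic of Delta_d.  Almost symmetry says that for every integer x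
   exactly one of "x in H", "F - x in H", "x in PF'" holds; hence Delta_d is the
   Alexander dual of Delta_(F + N - d), except for the sets A with
   d - sum_(i in A) n_i in PF', which are minimal non-faces.  The theorem
   amounts to two inequalities and one identity between the Betti numbers in
   the degrees d and F + N - d, for each d.  All of these depend only on the pair
   (Delta_d, Delta_(F + N - d)), and there are finitely many pairs to check. *)

(** * Pairs of complexes on four vertices *)

Local Open Scope nat_scope.

(* The subset A of {0, 1, 2, 3} is encoded by the number k = sum_(i in A) 2^i. *)
Definition bit (k i : nat) : bool := odd (iter i half k).

Definition mask_size (k : nat) : nat := count (bit k) (iota 0 4).

Definition mask_weight (n : 'I_4 -> nat) (k : nat) : nat :=
  \sum_(i < 4) bit k i * n i.

Lemma bit_add (k i N : nat) : i < N -> bit (k + 2 ^ N) i = bit k i.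
Proof.
rewrite /bit; elim: i N k => [|i IHi] [|N] k //=; rewrite -?iterS ?iterSr => iN.
  by rewrite oddD oddX /= addbF.
by rewrite expnS mul2n halfD odd_double andbF add0n doubleK IHi.
Qed.

Lemma bit_top (k N : nat) : k < 2 ^ N -> bit (k + 2 ^ N) N.
Proof.
rewrite /bit; elim: N k => [|N IHN] k; first by case: k.
move=> kN; rewrite iterSr expnS mul2n halfD odd_double andbF add0n doubleK.
by apply: IHN; rewrite expnS mul2n in kN; lia.
Qed.

Lemma bit_subK (k i : nat) : k < 16 -> i < 4 -> bit k i ->
  forall j, j < 4 -> bit (k - 2 ^ i) j = bit k j && (j != i).
Proof.
move=> k16 i4 ki j j4.
have /allP/(_ k): all (fun k => all (fun i => bit k i ==> all (fun j =>
    bit (k - 2 ^ i) j == bit k j && (j != i)) (iota 0 4)) (iota 0 4)) (iota 0 16).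
  by [].
rewrite mem_iota => /(_ k16)/allP/(_ i); rewrite mem_iota => /(_ i4).
by rewrite ki => /allP/(_ j); rewrite mem_iota => /(_ j4)/eqP.
Qed.

Lemma bit_compl (k j : nat) : k < 16 -> j < 4 -> bit (15 - k) j = ~~ bit k j.
Proof.
move=> k16 j4; have /allP/(_ k): all (fun k => all (fun j =>
    bit (15 - k) j == ~~ bit k j) (iota 0 4)) (iota 0 16) by [].
by rewrite mem_iota => /(_ k16)/allP/(_ j); rewrite mem_iota => /(_ j4)/eqP.
Qed.

Section MaskWeight.
Variable n : 'I_4 -> nat.

Lemma mask_weight_sub k (i : 'I_4) : k < 16 -> bit k i ->
  mask_weight n k = mask_weight n (k - 2 ^ i) + n i.
Proof.
move=> k16 ki; rewrite /mask_weight (bigD1 i) //= [in RHS](bigD1 i) //=.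
rewrite ki bit_subK // ki eqxx mul0n add0n mul1n addnC; congr (_ + _).
apply: eq_bigr => j ji; rewrite bit_subK // -val_eqE /= in ji *.
by rewrite ji andbT.
Qed.

Lemma mask_weight_compl k : k < 16 ->
  mask_weight n (15 - k) + mask_weight n k = \sum_(i < 4) n i.
Proof.
move=> k16; rewrite /mask_weight -big_split; apply: eq_bigr => i _ /=.
by rewrite bit_compl //; case: bit; rewrite ?mul0n ?mul1n ?addn0.
Qed.

Lemma lt_pow4 (i : 'I_4) : 2 ^ i < 16.
Proof. by case: i => -[|[|[|[|//]]]]. Qed.

Lemma lt_pow4D (i j : 'I_4) : i != j :> nat ->
  2 ^ i + 2 ^ j < 16.
Proof. by case: i j => -[|[|[|[|//]]]] ? [] [|[|[|[]]]]. Qed.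

Lemma mask_weight0 : mask_weight n 0 = 0.
Proof. by rewrite /mask_weight big1 // => i _; case: i => -[|[|[|[]]]]. Qed.

Lemma mask_weight1 (i : 'I_4) : mask_weight n (2 ^ i) = n i.
Proof.
rewrite (@mask_weight_sub _ i) ?subnn ?mask_weight0 //.
  exact: lt_pow4.
by case: i => -[|[|[|[]]]].
Qed.

Lemma mask_weight2 (i j : 'I_4) : i != j :> nat ->
  mask_weight n (2 ^ i + 2 ^ j) = n i + n j.
Proof.
move=> ij; rewrite (@mask_weight_sub _ j) ?addnK ?mask_weight1 //.
  by case: i j ij => -[|[|[|[|//]]]] ? [] [|[|[|[]]]].
by case: i j ij => -[|[|[|[|//]]]] ? [] [|[|[|[]]]].
Qed.

End MaskWeight.

(* Here D is the set of masks of the faces of a simplicial complex. *)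
Section Components.
Variable D : nat -> bool.

(** The diagonal case puts a loop at every vertex, so that paths of a fixed length also cover the
    shorter ones. *)
Definition edge i j : bool := D (if i == j then 2 ^ i else 2 ^ i + 2 ^ j).

Definition step (r : rel nat) : rel nat :=
  fun i j => has (fun k => r i k && r k j) (iota 0 4).

(* Two vertices in the same component are joined by at most three edges. *)
Definition linked : rel nat := step (step edge).

(** For a vertex [i] of a complex this is the smallest vertex of its component; [find] returns the
    out-of-range value 4 if [i] is not a vertex. *)
Definition rep i : nat := find (linked i) (iota 0 4).

Definition leader i : bool := D (2 ^ i) && (rep i == i).

Definition ncomp : nat := count leader (iota 0 4).

(** The properties of [rep] used later: it selects one vertex in each component and is constant
    along edges. They hold for every complex, by the finite check. *)
Definition graph_ok : bool :=
  all (fun i => (D (2 ^ i) ==> [&& rep i < 4, linked i (rep i) & leader (rep i)])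
    && all (fun j => edge i j ==> (rep i == rep j)) (iota 0 4)) (iota 0 4).

Definition faces_of_parity (c : bool) : nat :=
  count (fun k => D k && (odd (mask_size k) == c)) (iota 0 16).

(** Both this complex and the one without faces have [ncomp] equal to 0; this one has reduced
    homology in degree -1. For Delta_d it means d = 0. *)
Definition only_empty : bool := D 0 && ~~ has (fun i => D (2 ^ i)) (iota 0 4).

End Components.

(** These encode the downward closed families of subsets of an N-element set: [lo] holds the masks
    without the top element, [hi] those with it, and [hi] must be contained in [lo]. For N = 4 there
    are 168. *)
Fixpoint monotone_seqs (N : nat) : seq bitseq :=
  if N is N'.+1 then
    [seq lh.1 ++ lh.2 |
       lh <- [seq (lo, hi) | lo <- monotone_seqs N', hi <- monotone_seqs N']
       & all2 implb lh.2 lh.1]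
  else [:: [:: false]; [:: true]].

Lemma mem_monotone_seqs N (s : bitseq) : size s = 2 ^ N ->
  (forall k i, k < 2 ^ N -> i < N -> bit k i ->
     nth false s k -> nth false s (k - 2 ^ i)) ->
  s \in monotone_seqs N.
Proof.
elim: N s => [|N IHN] s; first by case: s => [|[] [|]].
rewrite expnS mul2n -addnn => sz_s s_mono.
have sz_lo : size (take (2 ^ N) s) = 2 ^ N by rewrite size_takel // sz_s leq_addr.
have sz_hi : size (drop (2 ^ N) s) = 2 ^ N by rewrite size_drop sz_s addnK.
apply/mapP; exists (take (2 ^ N) s, drop (2 ^ N) s); rewrite /= ?cat_take_drop //.
rewrite mem_filter /=; apply/andP; split.
  rewrite all2E sz_lo sz_hi eqxx /=; apply/(all_nthP (false, false)) => k.
  rewrite size_zip sz_lo sz_hi minnn => kN.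
  rewrite nth_zip ?sz_lo ?sz_hi //= nth_drop nth_take //; apply/implyP.
  rewrite addnC => /(s_mono _ N); rewrite addnK; apply; rewrite ?bit_top //; lia.
apply: allpairs_f; apply: IHN => // k i kN iN.
  have kiN : k - 2 ^ i < 2 ^ N by apply: leq_ltn_trans (leq_subr _ _) kN.
  move=> ki; rewrite !nth_take //.
  by apply: s_mono => //; lia.
move=> ki; rewrite !nth_drop ![2 ^ N + _]addnC => sk.
(* This makes the truncated subtraction of [2 ^ i] commute with the addition of [2 ^ N]. *)
have le_ik : 2 ^ i <= k.
  rewrite leqNgt; apply: contraL ki => lt_ki; rewrite /bit.
  suff -> : iter i half k = 0 by [].
  elim: i k lt_ki {s_mono sk kN iN} => [|i IHi] k; first by case: k.
  by rewrite expnS mul2n iterSr => lt_ki; apply: IHi; lia.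
by rewrite addnBAC // s_mono ?bit_add //; lia.
Qed.

Section DualPair.

(* For D = Delta_d and D' = Delta_(F + N - d), the masks k missing in this sense
   are those with d - mask_weight k in PF'. *)
Definition missing (D D' : nat -> bool) k := ~~ D k && ~~ D' (15 - k).

(** The first clause reflects that F is not in H, the second that f + n_i is in H for every f in
    PF'. *)
Definition compatible (D D' : nat -> bool) : bool :=
  all (fun k => ~~ (D k && D' (15 - k)) && (missing D D' k ==>
    all (fun i => bit k i ==> D (k - 2 ^ i)) (iota 0 4))) (iota 0 16).

(** The lists are the masks of size three and two. Missing faces of these sizes count the values f +
    N - n_i and f + n_i + n_j, respectively. *)
Definition missing3 D D' := count (missing D D') [:: 7; 11; 13; 14].
Definition missing2 D D' := count (missing D D') [:: 3; 5; 6; 9; 10; 12].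

Lemma missing3E D D' : missing3 D D' = \sum_(i < 4) missing D D' (15 - 2 ^ i).
Proof.
pose M k : nat := missing D D' k; rewrite !big_ord_recr big_ord0.
rewrite -[RHS]/(0 + M 14 + M 13 + M 11 + M 7) /missing3 /= -!/(M _); lia.
Qed.

Lemma missing2E D D' : missing2 D D' =
  \sum_(ij : 'I_4 * 'I_4 | ij.1 < ij.2) missing D D' (2 ^ ij.1 + 2 ^ ij.2).
Proof.
pose M k : nat := missing D D' k.
rewrite -(pair_big_dep xpredT (fun i j : 'I_4 => i < j)
  (fun i j : 'I_4 => M (2 ^ i + 2 ^ j))) /=.
under eq_bigr => i _ do rewrite big_mkcond /=.
rewrite !big_ord_recr !big_ord0 /= !add0n !addn0.
rewrite -[RHS]/(M 3 + M 5 + M 9 + (M 6 + M 10) + M 12).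
rewrite /missing2 /= -!/(M _); lia.
Qed.

(** The dimension of the reduced homology in degree 0; the truncated predecessor gives 0 when there
    are no vertices. *)
Definition betti1 D := (ncomp D).-1.

(** The two terms stand for d - N in PF' and for d - N = F. *)
Definition betti3 (D D' : nat -> bool) := missing D D' 15 + only_empty D'.

(* The value forced by the Euler characteristic; the first clause of betti_ok
   says that the subtraction is not truncated. *)
Definition betti2 D D' :=
  betti1 D + betti3 D D' + faces_of_parity D false -
  (faces_of_parity D true + only_empty D).

(** The second clause places the f + N - n_i among the b_j, the third reflects the remaining b_j
    into the a_i, and the last compares what is left of the a_i with the f + n_i + n_j. *)
Definition betti_ok (D D' : nat -> bool) : bool :=
  [&& faces_of_parity D true + only_empty D <=
        betti1 D + betti3 D D' + faces_of_parity D false,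
      missing3 D D' <= betti2 D D',
      betti2 D D' <= missing3 D D' + betti1 D' &
      betti1 D + betti1 D' + missing3 D D' + missing3 D' D ==
        missing2 D D' + betti2 D D' + betti2 D' D].

(* The filters are nested because vm_compute evaluates both arguments of &&. *)
Definition betti_check : bool :=
  all (fun s => graph_ok (nth false s) &&
    all (fun s' => betti_ok (nth false s) (nth false s'))
      [seq s' <- [seq s' <- [seq s' <- monotone_seqs 4
            | all2 (fun x y => ~~ (x && y)) s (rev s')]
          | compatible (nth false s) (nth false s')]
        | compatible (nth false s') (nth false s)])
    (monotone_seqs 4).

Lemma betti_checkT : betti_check.
Proof. by vm_compute. Qed.

Lemma graph_okT s : s \in monotone_seqs 4 -> graph_ok (nth false s).
Proof. by move=> s4; have /allP/(_ s s4)/andP[] := betti_checkT. Qed.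

Lemma betti_okT s s' : size s = 16 -> size s' = 16 ->
  s \in monotone_seqs 4 -> s' \in monotone_seqs 4 ->
  compatible (nth false s) (nth false s') ->
  compatible (nth false s') (nth false s) ->
  betti_ok (nth false s) (nth false s').
Proof.
move=> sz sz' s4 s4' c c'; have /allP/(_ s s4)/andP[_ /allP] := betti_checkT.
apply; rewrite !mem_filter c c' s4' !andbT /=.
(* Entry k of [rev s'] is entry 15 - k of [s'], so the innermost filter is a cheap form of the first
   clause of [compatible]. *)
rewrite all2E size_rev sz sz' eqxx; apply/(all_nthP (false, false)) => k.
rewrite size_zip size_rev sz sz' => k16.
rewrite nth_zip ?size_rev ?sz ?sz' //= nth_rev ?sz' //.
by have /allP/(_ k) := c; rewrite mem_iota => /(_ k16)/andP[].
Qed.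

End DualPair.

Lemma graph_ok_rep D i : graph_ok D -> i < 4 -> D (2 ^ i) ->
  [/\ rep D i < 4, linked D i (rep D i) & leader D (rep D i)].
Proof.
move=> /allP/(_ i); rewrite mem_iota => Dok i4 Di.
by have := Dok i4; rewrite Di => /andP[/and3P].
Qed.

Lemma graph_ok_edge D i j : graph_ok D -> i < 4 -> j < 4 -> edge D i j ->
  rep D i = rep D j.
Proof.
move=> /allP/(_ i); rewrite mem_iota => Dok i4 j4 Dij.
have /andP[_ /allP/(_ j)] := Dok i4.
by rewrite mem_iota Dij => /(_ j4)/eqP.
Qed.

Local Open Scope ring_scope.

(** * Degree strands of a graded complex *)

Section MonomialFunctional.
Variable K : fieldType.
Local Notation S := {mpoly K[4]}.

(** The linear functional on S with value [w u] at x^u. Coefficients of p, coefficients of its toric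
    image and the forms attached to components all have this shape. *)
Definition mform (w : 'X_{1..4} -> K) (p : S) : K :=
  \sum_(u <- msupp p) p@_u * w u.

Lemma mformE w k p : (msize p <= k)%N ->
  mform w p = \sum_(u : 'X_{1..4 < k}) p@_u * w u.
Proof.
move=> le_pk; pose I : subFinType _ := 'X_{1..4 < k}.
rewrite /mform (big_mksub I) ?msupp_uniq //=; last first.
  by move=> x /msize_mdeg_lt /leq_trans; apply.
by rewrite big_rmcond //= => i; move/memN_msupp_eq0 ->; rewrite mul0r.
Qed.

Lemma mform_is_scalar w : scalar (mform w).
Proof.
move=> c p q; pose k := maxn (msize (c *: p + q)) (maxn (msize p) (msize q)).
rewrite !(@mformE w k) ?leq_max ?leqnn ?orbT // mulr_sumr -big_split /=.
by apply: eq_bigr => u _; rewrite mcoeffD mcoeffZ mulrDl mulrA.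
Qed.

HB.instance Definition _ w :=
  GRing.isLinear.Build K S K _ (mform w) (mform_is_scalar w).

Lemma mformX w u : mform w 'X_[u] = w u.
Proof. by rewrite /mform msuppX big_seq1 mcoeffX eqxx mul1r. Qed.

Lemma eq_mform w w' p : {in msupp p, w =1 w'} -> mform w p = mform w' p.
Proof. by move=> ww'; apply: eq_big_seq => u /ww' ->. Qed.

Lemma mform_MX w u p : mform w ('X_[u] * p) = mform (fun v => w (u + v)%MM) p.
Proof.
rewrite {1}[p]mpolyE mulr_sumr linear_sum /=; apply: eq_bigr => v _.
by rewrite -scalerAr linearZ /= -mpolyXD mformX.
Qed.

Lemma mcoeff_mform u p : p@_u = mform (fun v => (v == u)%:R) p.
Proof.
rewrite {1}[p]mpolyE linear_sum /=; apply: eq_bigr => v _.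
by rewrite mcoeffZ mcoeffX.
Qed.

Lemma mform_mulE w p q :
  mform w (p * q) = \sum_(u <- msupp p) p@_u * mform w ('X_[u] * q).
Proof.
rewrite {1}[p]mpolyE mulr_suml linear_sum /=; apply: eq_bigr => u _.
by rewrite -scalerAl linearZ.
Qed.

(** The bound is on the weight: p may have terms of any degree, and the functional ignores those
    beyond the bound. *)
Lemma mform_bounded w k p : (forall u, (k <= mdeg u)%N -> w u = 0) ->
  mform w p = \sum_(v : 'X_{1..4 < k}) p@_v * w v.
Proof.
move=> w0; under eq_bigr => v _ do rewrite (mcoeff_mform v) /mform mulr_suml.
rewrite exchange_big /=; apply: eq_bigr => u _.
under eq_bigr => v _ do rewrite -mulrA.
rewrite -mulr_sumr; congr (_ * _).
have [ku|uk] := leqP k (mdeg u).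
  rewrite w0 // big1 // => v _; case: eqP => [uv|]; last by rewrite mul0r.
  by have := bmdeg v; rewrite -uv ltnNge ku.
rewrite (bigD1 (BMultinom uk)) //= eqxx mul1r big1 ?addr0 // => v.
by rewrite -val_eqE /= eq_sym => /negbTE ->; rewrite mul0r.
Qed.

End MonomialFunctional.

Section Degrees.
Variables (K : fieldType) (n : 'I_4 -> nat).
Local Notation S := {mpoly K[4]}.

Lemma wdegD u v : wdeg n (u + v)%MM = (wdeg n u + wdeg n v)%N.
Proof.
by rewrite /wdeg -big_split; apply: eq_bigr => i _; rewrite mnmDE mulnDl.
Qed.

Lemma wdeg0 : wdeg n 0%MM = 0%N.
Proof. by rewrite /wdeg big1 // => i _; rewrite mnm0E. Qed.

Lemma wdegU i : wdeg n U_(i)%MM = n i.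
Proof.
rewrite /wdeg (bigD1 i) //= mnm1E eqxx mul1n big1 ?addn0 // => j ji.
by rewrite mnm1E eq_sym (negbTE ji).
Qed.

Lemma toric_mapX u : toric_map n 'X_[u] = 'X^(wdeg n u) :> {poly K}.
Proof.
rewrite /toric_map mmapX /mmap1 /wdeg.
rewrite (eq_bigr (fun i => 'X^(u i * n i))) => [|i _].
  by rewrite prodrXr.
by rewrite -exprM mulnC.
Qed.

Lemma coef_toric_map (p : S) e :
  (toric_map n p)`_e = mform (fun u => (wdeg n u == e)%:R) p.
Proof.
rewrite /mform {1}[p]mpolyE /toric_map raddf_sum /= coef_sum.
apply: eq_bigr => u _; rewrite mmapZ coefCM; congr (_ * _).
by have := toric_mapX u; rewrite /toric_map => ->; rewrite coefXn eq_sym.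
Qed.

Lemma homogeneous_coef d (p : S) u :
  homogeneous n d p -> (wdeg n u)%:Z != d -> p@_u = 0.
Proof.
move=> hp /eqP ud; apply/eqP; apply: contraTT isT; rewrite -mcoeff_msupp.
by move/hp.
Qed.

Lemma toric_map_eq0 d (p : S) : homogeneous n d p ->
  mform (fun u => ((wdeg n u)%:Z == d)%:R) p = 0 -> toric_map n p = 0.
Proof.
move=> hp p0; apply/polyP => e; rewrite coef_toric_map coef0.
have [ed|ed] := eqVneq e%:Z d.
  by rewrite -p0; apply: eq_mform => u _; rewrite -ed eqz_nat.
rewrite /mform big1_seq // => u /andP[_ /hp ud].
by rewrite (_ : _ == _ = false) ?mulr0 // -eqz_nat ud eq_sym (negbTE ed).
Qed.

Lemma mform_toric_map d (p : S) : toric_map n p = 0 ->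
  mform (fun u => ((wdeg n u)%:Z == d)%:R) p = 0.
Proof.
case: d => e p0; first by rewrite -(coef_toric_map p e) p0 coef0.
by rewrite /mform big1 // => u _; rewrite mulr0.
Qed.

End Degrees.

(* A strand is the degree d part of (+)_j S(-b_j); its basis consists of the
   x^u e_j with wdeg u + b_j = d. *)
Section Strand.
Variables (K : fieldType) (n : 'I_4 -> nat) (D : nat) (d : int).
Local Notation S := {mpoly K[4]}.

Definition strand_basis q (b : 'I_q -> int) : {pred 'I_q * 'X_{1..4 < D}} :=
  [pred x : 'I_q * 'X_{1..4 < D} | (wdeg n x.2)%:Z + b x.1 == d].

Lemma mem_strand q (b : 'I_q -> int) x :
  (x \in strand_basis b) = ((wdeg n x.2)%:Z + b x.1 == d).
Proof. by []. Qed.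

Definition strand_dim q (b : 'I_q -> int) : nat := #|strand_basis b|.

Lemma sum_strand (R : nmodType) q (b : 'I_q -> int)
    (G : 'I_q * 'X_{1..4 < D} -> R) :
  \sum_(x < strand_dim b) G (enum_val (A := strand_basis b) x) =
  \sum_j \sum_(u : 'X_{1..4 < D} | (wdeg n u)%:Z + b j == d) G (j, u).
Proof.
rewrite -(big_enum_val (A := strand_basis b) G) pair_big_dep /=.
by apply: eq_big => -[].
Qed.

(** The cut-off D, which makes the basis finite, then loses nothing: the strand is the whole degree
    d part. *)
Definition bounded_by q (b : 'I_q -> int) :=
  forall j u, (wdeg n u)%:Z + b j = d -> (mdeg u < D)%N.

Definition homogeneous_row q (b : 'I_q -> int) (v : 'rV[S]_q) :=
  forall j, homogeneous n (d - b j) (v 0 j).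

Definition homogeneous_mx q m (b : 'I_q -> int) (a : 'I_m -> int)
    (A : 'M[S]_(q, m)) :=
  forall i j, homogeneous n (b i - a j) (A i j).

Section Encode.
Variables (q : nat) (b : 'I_q -> int).
Local Notation X := (strand_basis b).

Definition strand_enc (v : 'rV[S]_q) : 'rV[K]_(strand_dim b) :=
  \row_x let y := enum_val (A := X) x in (v 0 y.1)@_(y.2).

Definition strand_dec (x : 'rV[K]_(strand_dim b)) : 'rV[S]_q :=
  \row_j \sum_(y | (enum_val (A := X) y).1 == j)
    x 0 y *: 'X_[(enum_val (A := X) y).2].

Lemma strand_enc0 : strand_enc 0 = 0.
Proof. by apply/rowP => y; rewrite mxE /= !mxE mcoeff0. Qed.

Lemma strand_decK : cancel strand_dec strand_enc.
Proof.
move=> x; apply/rowP => y; rewrite mxE /= mxE raddf_sum /= (bigD1 y) //=.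
rewrite mcoeffZ mcoeffX eqxx mulr1 big1 ?addr0 // => z /andP[/eqP z1 zy].
rewrite mcoeffZ mcoeffX; case: eqP => [z2|]; last by rewrite mulr0.
case/eqP: zy; apply: enum_val_inj; apply/eqP; rewrite -pair_eqE /pair_eq /=.
by rewrite z1 eqxx /= -val_eqE /= z2.
Qed.

Lemma homogeneous_strand_dec x : homogeneous_row b (strand_dec x).
Proof.
move=> j u; rewrite mcoeff_msupp mxE raddf_sum /= => nz.
have [y /andP[/eqP y1 /eqP y2]|no] :=
  pickP (fun y => ((enum_val (A := X) y).1 == j) &&
      ((enum_val (A := X) y).2 == u :> 'X_{1..4})).
  have := enum_valP y; rewrite mem_strand y1 y2 => /eqP <-; by rewrite addrK.
case/eqP: nz; rewrite big1 // => y yj; rewrite mcoeffZ mcoeffX.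
by have := no y; rewrite yj /= => ->; rewrite mulr0.
Qed.

Hypothesis bD : bounded_by b.

Lemma strand_enc_eq0 v : homogeneous_row b v -> strand_enc v = 0 -> v = 0.
Proof.
move=> hv v0; apply/rowP => j; apply/mpolyP => u; rewrite mxE mcoeff0.
have [ud|ud] := eqVneq ((wdeg n u)%:Z) (d - b j); last first.
  exact: homogeneous_coef (hv j) ud.
have uD : (mdeg u < D)%N by apply: (bD (j := j)); rewrite ud subrK.
have jX : (j, BMultinom uD) \in X by rewrite mem_strand /= ud subrK.
move/rowP/(_ (enum_rank_in jX (j, BMultinom uD))): v0.
by rewrite !mxE enum_rankK_in.
Qed.

End Encode.

Section StrandMatrix.
Variables (q m : nat) (b : 'I_q -> int) (a : 'I_m -> int) (A : 'M[S]_(q, m)).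
Hypothesis gA : homogeneous_mx b a A.

Definition strand_mx : 'M[K]_(strand_dim b, strand_dim a) :=
  \matrix_(x, y) let x' := enum_val (A := strand_basis b) x in
    let y' := enum_val (A := strand_basis a) y in
    ('X_[x'.2] * A x'.1 y'.1)@_(y'.2).

Lemma strand_enc_mul (v : 'rV[S]_q) : bounded_by b ->
  strand_enc a (v *m A) = strand_enc b v *m strand_mx.
Proof.
move=> bD; apply/rowP => y; rewrite !mxE.
set i := (enum_val (A := strand_basis a) y).1.
set w : 'X_{1..4} := (enum_val (A := strand_basis a) y).2.
have yd : (wdeg n w)%:Z + a i = d.
  by have := enum_valP y; rewrite mem_strand => /eqP.
(* Since A is homogeneous, terms of v outside degree d do not reach the degree d coefficients of the
   product. *)
have out j u : (wdeg n u)%:Z + b j != d -> ('X_[u] * A j i)@_w = 0.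
  rewrite mcoeff_mform mform_MX /mform => ud; apply: big1_seq => x /andP[_ xA].
  case: eqP => [uxw|]; last by rewrite mulr0.
  case/eqP: ud; rewrite -yd -uxw wdegD PoszD (gA xA); ring.
pose G (x : 'I_q * 'X_{1..4 < D}) := (v 0 x.1)@_x.2 * ('X_[x.2] * A x.1 i)@_w.
under [RHS]eq_bigr => x _ do rewrite !mxE -/i -/w.
rewrite (sum_strand _ G) /= -/i -/w mxE raddf_sum /=; apply: eq_bigr => j _.
rewrite mcoeff_mform mform_mulE.
rewrite (eq_bigr (fun u => (v 0 j)@_u * ('X_[u] * A j i)@_w)); last first.
  by move=> u _; congr (_ * _); exact/esym/mcoeff_mform.
rewrite -/(mform (fun u => ('X_[u] * A j i)@_w) _) (@mform_bounded _ _ D).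
  rewrite [RHS]big_mkcond /=. apply: eq_bigr => u _; case: ifPn => // ud.
  by rewrite out ?mulr0.
move=> u Du; apply: out; apply: contraTN Du => /eqP /bD.
by rewrite ltnNge.
Qed.

Lemma homogeneous_row_mul v : homogeneous_row b v -> homogeneous_row a (v *m A).
Proof.
move=> hv i w wi; apply/eqP; apply: contraTT wi => wd.
rewrite mcoeff_msupp mxE negbK raddf_sum big1 //= => j _.
rewrite mcoeff_mform mform_mulE big1_seq // => u /andP[_ uv].
rewrite mform_MX /mform big1_seq ?mulr0 // => x /andP[_ xA].
case: eqP => [uxw|]; last by rewrite mulr0.
case/eqP: wd; rewrite -uxw wdegD PoszD (hv _ _ uv) (gA xA); ring.
Qed.

(** A kernel vector of the strand matrix decodes to a homogeneous row killed by A. *)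
Lemma rank_strand_inj : bounded_by b -> bounded_by a ->
  (forall u : 'rV_q, u *m A = 0 -> u = 0) -> \rank strand_mx = strand_dim b.
Proof.
move=> bD aD injA; apply/eqP; rewrite -[_ == _]/(row_free _) -kermx_eq0.
apply/eqP/row_matrixP => i; rewrite row0; set x := row i _.
have xM : x *m strand_mx = 0 by apply/sub_kermxP/row_sub.
rewrite -[x](strand_decK) in xM *; rewrite -strand_enc_mul // in xM.
rewrite (injA (strand_dec x)) ?strand_enc0 //.
apply: strand_enc_eq0 xM => //; apply: homogeneous_row_mul.
exact: homogeneous_strand_dec.
Qed.

End StrandMatrix.

Lemma rank_strand_exact q m r (b : 'I_q -> int) (a : 'I_m -> int)
  (c : 'I_r -> int) (A : 'M[S]_(q, m)) (B : 'M[S]_(m, r)) :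
  homogeneous_mx b a A -> homogeneous_mx a c B ->
  bounded_by b -> bounded_by a -> bounded_by c -> exact_at A B ->
  (\rank (strand_mx b a A) + \rank (strand_mx a c B))%N = strand_dim a.
Proof.
move=> gA gB bD aD cD ex.
suff -> : \rank (strand_mx b a A) = \rank (kermx (strand_mx a c B)).
  by rewrite mxrank_ker subnK // rank_leq_row.
apply/eqmx_rank/andP; split.
  apply/sub_kermxP/row_matrixP => i; rewrite row_mul row0.
  rewrite rowE -[delta_mx 0 i](strand_decK).
  rewrite -(strand_enc_mul gA) // -(strand_enc_mul gB) // -mulmxA.
  rewrite mulmxA (ex _).2; last by exists (strand_dec (delta_mx 0 i)).
  exact: strand_enc0.
apply/row_subP => i; set x := row i _.
have xM : x *m strand_mx a c B = 0 by apply/sub_kermxP/row_sub.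
have : strand_dec x *m B = 0.
  apply: (strand_enc_eq0 cD); last by rewrite (strand_enc_mul gB) // strand_decK.
  apply: (homogeneous_row_mul gB); exact: homogeneous_strand_dec.
(* The preimage [u] need not be homogeneous; encoding it keeps its degree d part, which is
   enough. *)
case/ex => u xu; rewrite -[x]strand_decK xu (strand_enc_mul gA) //.
exact: submxMl.
Qed.

(** The degree d part of K[H] has dimension 1 if S has a monomial of degree d and 0 otherwise; on
    the strand the toric map is the sum of the coefficients, given by the column [o] of ones. *)
Lemma rank_strand_toric q (b : 'I_q -> int) (A : 'M[S]_(q, 1)) :
  homogeneous_mx b (fun _ : 'I_1 => 0) A ->
  bounded_by b -> bounded_by (fun _ : 'I_1 => 0) ->
  (forall v : S, toric_map n v = 0 <-> exists u : 'rV[S]_q, v = (u *m A) 0 0) ->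
  (\rank (strand_mx b (fun=> 0) A) + (0 < strand_dim (fun _ : 'I_1 => 0)))%N
    = strand_dim (fun _ : 'I_1 => 0).
Proof.
set z := (fun _ : 'I_1 => 0) => gA bD zD ex.
pose o : 'M[K]_(strand_dim z, 1) := const_mx 1.
have rk_o : \rank o = (0 < strand_dim z)%N.
  case: posnP => [z0|z0].
    by apply/eqP; rewrite -leqn0 -[leqRHS]z0 rank_leq_row.
  apply/eqP; rewrite eqn_leq rank_leq_col lt0n mxrank_eq0 /=.
  apply/eqP => /matrixP/(_ (Ordinal z0) 0)/eqP; rewrite !mxE.
  by rewrite oner_eq0.
have oE (v : 'rV[S]_1) : homogeneous_row z v -> (strand_enc z v *m o) 0 0 =
    mform (fun u => ((wdeg n u)%:Z == d)%:R) (v 0 0).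
  move=> hv; rewrite mxE.
  pose G (x : 'I_1 * 'X_{1..4 < D}) := (v 0 x.1)@_x.2.
  under eq_bigr => x _ do rewrite !mxE mulr1.
  rewrite (sum_strand _ G) big_ord1 big_mkcond (@mform_bounded _ _ D).
    apply: eq_bigr => u _; rewrite /z addr0.
    by case: ifP; rewrite ?mulr1 ?mulr0.
  move=> u Du; case: eqP => // ud; move: Du; rewrite leqNgt.
  by rewrite (zD 0) // addr0.
suff -> : \rank (strand_mx b z A) = \rank (kermx o).
  by rewrite mxrank_ker rk_o subnK // -rk_o rank_leq_row.
apply/eqmx_rank/andP; split.
  apply/sub_kermxP/row_matrixP => i; rewrite row_mul row0 rowE.
  rewrite -[delta_mx 0 i](strand_decK) -(strand_enc_mul gA) //.
  apply/rowP => j; rewrite ord1 oE; last first.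
    apply: (homogeneous_row_mul gA); exact: homogeneous_strand_dec.
  rewrite [RHS]mxE; apply: mform_toric_map; apply/ex.
  by exists (strand_dec (delta_mx 0 i)).
apply/row_subP => i; set x := row i _.
have xM : x *m o = 0 by apply/sub_kermxP/row_sub.
have hx : homogeneous_row z (strand_dec x) by exact: homogeneous_strand_dec.
have : toric_map n ((strand_dec x) 0 0) = 0.
  apply: (@toric_map_eq0 _ _ d); first by have := hx 0; rewrite /z subr0.
  by rewrite -oE // strand_decK xM mxE.
case/ex => u xu; rewrite -[x]strand_decK.
have -> : strand_dec x = u *m A by apply/rowP => j; rewrite ord1.
by rewrite (strand_enc_mul gA) // submxMl.
Qed.

End Strand.

(** * Hilbert functions *)

Lemma sign_sum_faces (D : nat -> bool) :
  \sum_(k < 16) (-1) ^+ mask_size k * (D k)%:R =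
    (faces_of_parity D false)%:R - (faces_of_parity D true)%:R :> int.
Proof.
have parE c : (faces_of_parity D c)%:R =
    \sum_(k < 16) (D k && (odd (mask_size k) == c))%:R :> int.
  rewrite /faces_of_parity -sum1_count -[iota 0 16]/(index_iota 0 16) big_mkord.
  by rewrite natr_sum big_mkcond; apply: eq_bigr => k _; case: (_ && _).
rewrite !parE -sumrB; apply: eq_bigr => k _; rewrite -signr_odd.
by case: (D k); case: odd.
Qed.

Section HilbertSeries.
Variables (n : 'I_4 -> nat).
Hypothesis n_gt0 : forall i, (0 < n i)%N.

(** For e < D this is the Hilbert function of S at e, since total degree is at most weighted
    degree. *)
Definition hilb D (e : int) : nat :=
  #|[pred u : 'X_{1..4 < D} | (wdeg n u)%:Z == e]|.

Lemma strand_dimE D d q (b : 'I_q -> int) :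
  strand_dim n D d b = (\sum_j hilb D (d - b j))%N.
Proof.
rewrite -[LHS]card_ord -sum1_card (@sum_strand n D d _ _ b (fun=> 1%N)).
apply: eq_bigr => j _; rewrite /hilb -sum1_card; apply: eq_bigl => u.
by rewrite inE eq_sym -subr_eq eq_sym.
Qed.

Lemma mdeg_le_wdeg u : (mdeg u <= wdeg n u)%N.
Proof.
by rewrite mdegE /wdeg; apply: leq_sum => i _; rewrite -{1}[u i]muln1 leq_mul.
Qed.

Lemma bounded_byP D d q (b : 'I_q -> int) :
  (forall j, d - b j < D%:Z) -> bounded_by n D d b.
Proof.
move=> bD j u ud; apply: leq_ltn_trans (mdeg_le_wdeg u) _.
by have := bD j; rewrite -ud addrK.
Qed.

Definition supported (k : nat) (u : 'X_{1..4}) : bool :=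
  all (fun i => bit k i ==> (0 < u (inord i))%N) (iota 0 4).

Definition mask_mnm (k : nat) : 'X_{1..4} := [multinom (bit k i : nat) | i < 4].

Lemma supportedE k u : supported k u = (mask_mnm k <= u)%MM.
Proof.
apply/allP/mnm_lepP => [ku i|ku i].
  rewrite mnmE; have := ku i; rewrite mem_iota ltn_ord => /(_ isT).
  by rewrite inord_val; case: bit.
rewrite mem_iota /= => i4; have := ku (inord i); rewrite mnmE inordK //.
by case: bit.
Qed.

Lemma wdeg_mask k : wdeg n (mask_mnm k) = mask_weight n k.
Proof. by apply: eq_bigr => i _; rewrite mnmE. Qed.

(** Multiplication by the squarefree monomial of the mask is a bijection onto the monomials that it
    divides. *)
Lemma hilb_mask D (e : int) k : e < D%:Z ->
  hilb D (e - (mask_weight n k)%:Z) =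
  #|[pred u : 'X_{1..4 < D} | ((wdeg n u)%:Z == e) && supported k u]|.
Proof.
move=> eD; rewrite /hilb -[LHS]cardsE -[RHS]cardsE.
have addP (u : 'X_{1..4}) : (wdeg n u)%:Z == e - (mask_weight n k)%:Z ->
   (mdeg (u + mask_mnm k) < D)%N.
  move=> ue; apply: leq_ltn_trans (mdeg_le_wdeg _) _.
  by rewrite wdegD wdeg_mask; lia.
pose f (u : 'X_{1..4 < D}) : 'X_{1..4 < D} := insubd u (u + mask_mnm k)%MM.
rewrite -[LHS](@card_in_imset _ _ f) => [|u v].
  apply: eq_card => u; rewrite !inE; apply/imsetP/andP; last first.
    case=> /= /eqP ue; rewrite supportedE => ku.
    have uD : (mdeg (u - mask_mnm k) < D)%N.
      exact: leq_ltn_trans (mdegB _ _) (bmdeg u).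
    exists (BMultinom uD); last first.
      by apply: val_inj; rewrite val_insubd /= submK // bmdeg.
    have := wdegD n (u - mask_mnm k) (mask_mnm k).
    by rewrite submK // !inE /= wdeg_mask; lia.
  case=> v; rewrite !inE => ve ->; rewrite val_insubd addP //.
  split; first by rewrite wdegD wdeg_mask; lia.
  by rewrite supportedE lem_addl.
rewrite !inE => ue ve /(congr1 val); rewrite !val_insubd !addP //.
by rewrite addmC [RHS]addmC => /addmI uv; apply: val_inj.
Qed.

Lemma sign_sum_subsets (s : nat -> bool) :
  \sum_(k < 16)
    (-1) ^+ mask_size k * (all (fun i => bit k i ==> s i) (iota 0 4))%:R
    = (all (fun i => ~~ s i) (iota 0 4))%:R :> int.
Proof.
rewrite !big_ord_recr big_ord0 /=.
by case: (s 0%N) (s 1%N) (s 2%N) (s 3%N) => [] [] [] [].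
Qed.

Lemma sign_sum_supported u :
  \sum_(k < 16) (-1) ^+ mask_size k * (supported k u)%:R = (u == 0%MM)%:R :> int.
Proof.
have -> : (u == 0%MM) = all (fun i => ~~ (0 < u (inord i))%N) (iota 0 4).
  apply/eqP/allP => [-> i _|u0]; first by rewrite mnm0E.
  apply/mnmP => i; rewrite mnm0E; apply/eqP; rewrite -leqn0 leqNgt.
  by have := u0 i; rewrite mem_iota ltn_ord inord_val; apply.
exact: (sign_sum_subsets (fun i => 0 < u (inord i))%N).
Qed.

(** This is the degree e coefficient of the identity saying that the Hilbert series of S times the
    product of the 1 - t^(n_i) is 1. It follows by inclusion-exclusion over the support of each
    monomial. *)
Lemma sign_sum_hilb D (e : int) : e < D%:Z ->
  \sum_(k < 16) (-1) ^+ mask_size k * (hilb D (e - (mask_weight n k)%:Z))%:R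
    = (e == 0)%:R :> int.
Proof.
move=> eD.
transitivity (\sum_(u : 'X_{1..4 < D} | (wdeg n u)%:Z == e)
   \sum_(k < 16) (-1) ^+ mask_size k * (supported k u)%:R : int).
  rewrite exchange_big; apply: eq_bigr => k _ /=.
  rewrite hilb_mask // -mulr_sumr; congr (_ * _).
  rewrite -sum1_card natr_sum [in RHS]big_mkcond [in LHS]big_mkcond /=.
  by apply: eq_bigr => u _; rewrite inE; case: eqP; case: supported.
under eq_bigr => u _ do rewrite sign_sum_supported.
have [D0|D0] := posnP D.
  rewrite big1 => [|u _]; first by case: eqP => // e0; move: eD; rewrite e0 D0.
  by have := bmdeg u; rewrite [X in (_ < X)%N]D0.
have bm0P : (mdeg (0%MM : 'X_{1..4}) < D)%N by rewrite mdeg0.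
rewrite big_mkcond (bigD1 (BMultinom bm0P)) //= wdeg0 eqxx [0 == e]eq_sym.
rewrite big1 ?addr0 => [|u]; first by case: eqP.
by rewrite -val_eqE /= => /negbTE ->; case: ifP.
Qed.

End HilbertSeries.

(** * Euler characteristic of the resolution *)

Section EulerCharacteristic.
Variables (K : fieldType) (n : 'I_4 -> nat).
Hypothesis n_gt0 : forall i, (0 < n i)%N.
Variables (p q m : nat) (c : p.-tuple int) (b : q.-tuple int) (a : m.-tuple int).
Variables (d3 : 'M[{mpoly K[4]}]_(p, q)) (d2 : 'M[{mpoly K[4]}]_(q, m))
  (d1 : 'M[{mpoly K[4]}]_(m, 1)).
Hypothesis res : graded_min_free_res n c b a d3 d2 d1.

(** The strand dimensions are sums of ranks of consecutive maps, which cancel in the alternating sum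
    and leave the dimension of K[H] in degree d. *)
Lemma hilb_res D (d : int) : d < D%:Z ->
  (forall i, d - tnth a i < D%:Z) -> (forall i, d - tnth b i < D%:Z) ->
  (forall i, d - tnth c i < D%:Z) ->
  (hilb n D d)%:R - \sum_i (hilb n D (d - tnth a i))%:R
    + \sum_i (hilb n D (d - tnth b i))%:R
    - \sum_i (hilb n D (d - tnth c i))%:R = (0 < hilb n D d)%N%:R :> int.
Proof.
move=> dD aD bD cD.
pose z := fun _ : 'I_1 => 0 : int.
have zB : bounded_by n D d z by apply: bounded_byP => // j; rewrite subr0.
have aB := bounded_byP n_gt0 aD; have bB := bounded_byP n_gt0 bD.
have cB := bounded_byP n_gt0 cD.
have g1 : homogeneous_mx n (tnth a) z d1.
  by move: (gr1 res) => g i j; have := g i j; rewrite [j]ord1.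
have [r1 [r2 [r3 []]]] : exists r1 r2 r3 : nat,
    [/\ r3 = strand_dim n D d (tnth c), (r3 + r2)%N = strand_dim n D d (tnth b),
      (r2 + r1)%N = strand_dim n D d (tnth a) &
      (r1 + (0 < strand_dim n D d z))%N = strand_dim n D d z].
  exists (\rank (strand_mx n D d (tnth a) z d1)).
  exists (\rank (strand_mx n D d (tnth b) (tnth a) d2)).
  exists (\rank (strand_mx n D d (tnth c) (tnth b) d3)); split.
  - exact: rank_strand_inj (gr3 res) cB bB (inj3 res).
  - exact: rank_strand_exact (gr3 res) (gr2 res) cB bB aB (exact2 res).
  - exact: rank_strand_exact (gr2 res) g1 bB aB zB (exact1 res).
  - exact: rank_strand_toric g1 aB zB (exact0 res).
rewrite !strand_dimE big_ord1 subr0 -!natr_sum => <- <- <- {1}<-.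
rewrite !natrD; ring.
Qed.

(** Multiplying the Hilbert series of the resolution by the product of the 1 - t^(n_i) turns each
    S(-x) into t^x, and K[H] into signed counts of faces. *)
Lemma euler_char (mem : int -> bool) (d : int) :
  (forall e, mem e <-> exists u, (wdeg n u)%:Z = e) ->
  (d == 0)%:R - (count_mem d a)%:R + (count_mem d b)%:R - (count_mem d c)%:R
    = \sum_(k < 16)
        (-1) ^+ mask_size k * (mem (d - (mask_weight n k)%:Z))%:R :> int.
Proof.
move=> memP.
pose S s := (\sum_(x <- s) `|d - x|)%N.
(* This exceeds d and every d - x with x a shift, so all strands in degrees at most d are
   complete. *)
pose D := (`|d| + S a + S b + S c).+1.
have inS r (s : r.-tuple int) i : d - tnth s i <= (S s)%:Z.
  rewrite /S big_tuple (bigD1 i) //=; lia.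
have le_mask k : d - (mask_weight n k)%:Z <= d by lia.
have dD : d < D%:Z by rewrite /D; lia.
have lt_D r (s : r.-tuple int) i k : (S s < D)%N ->
    d - (mask_weight n k)%:Z - tnth s i < D%:Z.
  by move=> sD; have := inS r s i; have := le_mask k; lia.
have aD i k : d - (mask_weight n k)%:Z - tnth a i < D%:Z by apply: lt_D; lia.
have bD i k : d - (mask_weight n k)%:Z - tnth b i < D%:Z by apply: lt_D; lia.
have cD i k : d - (mask_weight n k)%:Z - tnth c i < D%:Z by apply: lt_D; lia.
have countE r (s : r.-tuple int) : (S s < D)%N -> (count_mem d s)%:R =
    \sum_(k < 16) (-1) ^+ mask_size k *
      \sum_i (hilb n D (d - (mask_weight n k)%:Z - tnth s i))%:R :> int.
  move=> sD; under eq_bigr => k _ do rewrite mulr_sumr.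
  rewrite exchange_big -sum1_count natr_sum big_tuple big_mkcond.
  apply: eq_bigr => i _ /=.
  under eq_bigr => k _ do rewrite addrAC.
  rewrite sign_sum_hilb //; last by have := inS r s i; lia.
  by rewrite subr_eq0 eq_sym; case: eqP.
rewrite !countE; try by lia.
rewrite -(sign_sum_hilb n_gt0 dD) -!sumrN -!big_split; apply: eq_bigr => k _ /=.
rewrite -!mulrN -!mulrDr hilb_res //; last exact: le_lt_trans (le_mask k) dD.
congr (_ * _%:R); congr nat_of_bool; apply/card_gt0P/idP => [[u]|].
  by rewrite inE => /eqP ue; apply/memP; exists u.
case/memP => u ue; have uD : (mdeg u < D)%N.
  apply: leq_ltn_trans (mdeg_le_wdeg n_gt0 u) _.
  by have := le_mask k; lia.
by exists (BMultinom uD); rewrite inE /= ue.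
Qed.

End EulerCharacteristic.

(** * Minimal generators of the toric ideal *)

Section MinimalGenerators.
Variables (K : fieldType) (n : 'I_4 -> nat) (m q : nat).
Hypothesis n_gt0 : forall i, (0 < n i)%N.
Local Notation S := {mpoly K[4]}.
Variables (d1 : 'M[S]_(m, 1)) (d2 : 'M[S]_(q, m)).
Hypotheses (min1 : minimal_map d1) (min2 : minimal_map d2).
Hypothesis exact1 : exact_at d2 d1.
Hypothesis exact0 : forall v : S,
  toric_map n v = 0 <-> exists u : 'rV[S]_m, v = (u *m d1) 0 0.

Local Notation gen i := (d1 i 0).

(* Membership in m I_H, where m = (x_1, ..., x_4). *)
Definition in_mI (p : S) : Prop :=
  exists v : 'rV[S]_m, (forall i, (v 0 i)@_0%MM = 0) /\ p = (v *m d1) 0 0.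

Lemma in_mI0 : in_mI 0.
Proof. by exists 0; split=> [i|]; rewrite ?mul0mx !mxE ?mcoeff0. Qed.

Lemma in_mID p r : in_mI p -> in_mI r -> in_mI (p + r).
Proof.
case=> v [v0 ->] [w [w0 ->]]; exists (v + w).
by split=> [i|]; rewrite ?mulmxDl !mxE // mcoeffD v0 w0 addr0.
Qed.

Lemma in_mIZ c p : in_mI p -> in_mI (c *: p).
Proof.
case=> v [v0 ->]; exists (c%:MP *: v); split=> [i|].
  by rewrite mxE mcoeffCM v0 mulr0.
by rewrite -scalemxAl [in RHS]mxE mul_mpolyC.
Qed.

Lemma in_mI_sum (T : eqType) (s : seq T) (F : T -> S) :
  (forall x, x \in s -> in_mI (F x)) -> in_mI (\sum_(x <- s) F x).
Proof.
move=> sF; rewrite big_seq; elim/big_ind: _ => //; first exact: in_mI0.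
exact: in_mID.
Qed.

Lemma in_mI_mulX i p : toric_map n p = 0 -> in_mI ('X_i * p).
Proof.
case/exact0 => v ->; exists ('X_i *: v); split=> [j|].
  rewrite mxE mcoeff_mform mform_MX /mform big1 // => u _.
  by rewrite mnmD_eq0 mnm1_eq0 mulr0.
by rewrite -scalemxAl [in RHS]mxE.
Qed.

Lemma toric_map_gen i : toric_map n (gen i) = 0.
Proof.
by apply/exact0; exists (delta_mx 0 i); rewrite -rowE mxE.
Qed.

Lemma toric_map_sub u v : wdeg n u = wdeg n v ->
  toric_map n ('X_[u] - 'X_[v] : S) = 0.
Proof.
move=> uv; apply/polyP => e.
by rewrite coef_toric_map linearB /= !mformX uv subrr coef0.
Qed.

Lemma mnm_subK i (u : 'X_{1..4}) : (0 < u i)%N -> (U_(i) + (u - U_(i)) = u)%MM.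
Proof.
move=> ui; rewrite addmC submK //; apply/mnm_lepP => j; rewrite mnm1E.
by case: eqP => // <-.
Qed.

(** Dividing by the common variable x_i leaves a binomial of I_H. *)
Lemma in_mI_shared i u v : wdeg n u = wdeg n v -> (0 < u i)%N -> (0 < v i)%N ->
  in_mI ('X_[u] - 'X_[v]).
Proof.
move=> uv ui vi; rewrite -(mnm_subK ui) -(mnm_subK vi) !mpolyXD -mulrBr.
apply/in_mI_mulX/toric_map_sub; apply/eqP.
by rewrite -(eqn_add2l (n i)) -wdegU -!wdegD !mnm_subK // uv.
Qed.

Section Degree.
Variables (mem : int -> bool) (d : int).
Hypothesis memP : forall e, mem e <-> exists u, (wdeg n u)%:Z = e.

Definition face_seq (e : int) : bitseq :=
  mkseq (fun k => mem (e - (mask_weight n k)%:Z)) 16.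

Local Notation D := (nth false (face_seq d)).

Lemma face_seqE e k : (k < 16)%N ->
  nth false (face_seq e) k = mem (e - (mask_weight n k)%:Z).
Proof. exact: nth_mkseq. Qed.

Lemma vertexP (i : 'I_4) :
  D (2 ^ i) <-> exists u, (wdeg n u)%:Z = d /\ (0 < u i)%N.
Proof.
rewrite face_seqE ?lt_pow4 // mask_weight1 memP; split=> -[u].
  move=> ud; exists (U_(i) + u)%MM; split; first by rewrite wdegD wdegU; lia.
  by rewrite mnmDE mnm1E eqxx.
case=> ud ui; exists (u - U_(i))%MM.
by have := wdegD n U_(i) (u - U_(i)); rewrite mnm_subK // wdegU; lia.
Qed.

Lemma edgeP (i j : 'I_4) :
  edge D i j <-> exists u, [/\ (wdeg n u)%:Z = d, (0 < u i)%N & (0 < u j)%N].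
Proof.
rewrite /edge; have [/val_inj<-|ij] := eqVneq (i : nat) j.
  by rewrite vertexP; split=> -[u []]; exists u.
rewrite face_seqE ?lt_pow4D // mask_weight2 // memP; split=> -[u].
  move=> ud; exists (U_(i) + (U_(j) + u))%MM; split.
  - by rewrite !wdegD !wdegU; lia.
  - by rewrite mnmDE mnm1E eqxx.
  - by rewrite !mnmDE !mnm1E eqxx addnCA.
case=> ud ui uj; exists (u - U_(i) - U_(j))%MM.
have uij : (0 < (u - U_(i))%MM j)%N.
  by rewrite mnmBE mnm1E -val_eqE /= (negbTE ij) subn0.
have := wdegD n U_(i) (u - U_(i)); rewrite mnm_subK // wdegU.
by have := wdegD n U_(j) (u - U_(i) - U_(j)); rewrite mnm_subK // wdegU; lia.
Qed.

(** The first clause gives transitivity: the intermediate vertex supplies a monomial to pass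
    through. *)
Definition joined (i j : nat) : Prop :=
  (exists u, (wdeg n u)%:Z = d /\ (0 < u (inord j))%N) /\
  forall u v, (wdeg n u)%:Z = d -> (wdeg n v)%:Z = d ->
    (0 < u (inord i))%N -> (0 < v (inord j))%N -> in_mI ('X_[u] - 'X_[v]).

Lemma joined_trans k i j : joined i k -> joined k j -> joined i j.
Proof.
case=> -[w [wd wk]] ik [ex_j kj]; split=> // u v ud vd ui vj.
rewrite -(subrK 'X_[w] 'X_[u]) -addrA; apply: in_mID; first exact: ik.
exact: kj.
Qed.

Lemma joined_step (r : rel nat) :
  (forall i j, (i < 4)%N -> (j < 4)%N -> r i j -> joined i j) ->
  forall i j, (i < 4)%N -> (j < 4)%N -> step r i j -> joined i j.
Proof.
move=> rJ i j i4 j4 /hasP[k]; rewrite mem_iota => k4 /andP[ik kj].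
by apply: joined_trans (rJ _ _ _ _ kj) => //; apply: rJ.
Qed.

(** For an edge, some monomial of degree d is divisible by both variables and shares one with each
    of the two given monomials. *)
Lemma linked_joined i j : (i < 4)%N -> (j < 4)%N -> linked D i j -> joined i j.
Proof.
apply: joined_step; apply: joined_step => {}i {}j i4 j4.
rewrite -{1}(inordK i4) -{1}(inordK j4) => /edgeP[w [wd wi wj]].
split; first by exists w.
move=> u v ud vd ui vj; rewrite -(subrK 'X_[w] 'X_[u]) -addrA.
by apply: in_mID; [apply: (in_mI_shared _ ui wi)|apply: (in_mI_shared _ wj vj)];
  apply/eqP; rewrite -eqz_nat; apply/eqP; rewrite ?ud ?vd ?wd.
Qed.

Hypothesis d_neq0 : d != 0.
Hypothesis Dok : graph_ok D.

(* x^u lies over the component of Delta_d with smallest vertex t. *)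
Definition lies_over (t : nat) (u : 'X_{1..4}) : bool :=
  [exists i : 'I_4, (0 < u i)%N && (rep D i == t)].

(** Any two variables dividing x^u span an edge, so the choice of the variable does not matter. *)
Lemma lies_overE t u (i : 'I_4) : (wdeg n u)%:Z = d -> (0 < u i)%N ->
  lies_over t u = (rep D i == t).
Proof.
move=> ud ui; apply/existsP/eqP => [[j /andP[uj /eqP <-]]|it]; last first.
  by exists i; rewrite ui it eqxx.
by apply: graph_ok_edge => //; apply/edgeP; exists u.
Qed.

Lemma ex_support u : (wdeg n u)%:Z = d -> exists i, (0 < u i)%N.
Proof.
move=> ud; apply/existsP; rewrite -[[exists _, _]]negbK negb_exists.
apply/forallP => u0; case/eqP: d_neq0; rewrite -ud.
have -> : u = 0%MM by apply/mnmP => i; rewrite mnm0E; have := u0 i; case: (u i).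
by rewrite wdeg0.
Qed.

Definition comp_form (t : nat) : S -> K :=
  mform (fun u => (((wdeg n u)%:Z == d) && lies_over t u)%:R).

HB.instance Definition _ t := GRing.Linear.on (comp_form t).

(** All terms of degree d in x_i p lie over the component of i, so the form is either 0 or the sum
    of the coefficients of p in degree d - n_i, which vanishes on I_H. *)
Lemma comp_form_mulX t i p : toric_map n p = 0 -> comp_form t ('X_i * p) = 0.
Proof.
move=> p0; rewrite /comp_form mform_MX.
transitivity ((rep D i == t)%:R *
    mform (fun u => ((wdeg n u)%:Z == d - (n i)%:Z)%:R) p).
  rewrite /mform mulr_sumr; apply: eq_bigr => u _; rewrite mulrCA; congr (_ * _).
  have -> : ((wdeg n (U_(i) + u))%:Z == d) = ((wdeg n u)%:Z == d - (n i)%:Z).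
    by rewrite wdegD wdegU; lia.
  case: eqP => /= [ud|]; last by rewrite mulr0.
  rewrite (@lies_overE _ _ i) ?mulr1 //; first by rewrite wdegD wdegU; lia.
  by rewrite mnmDE mnm1E eqxx.
by rewrite mform_toric_map ?mulr0.
Qed.

(** The terms of p divisible by some variable contribute nothing, so the form factors through I_H /
    m I_H. *)
Lemma comp_form_mul t p g : toric_map n g = 0 ->
  comp_form t (p * g) = p@_0%MM * comp_form t g.
Proof.
move=> g0; rewrite /comp_form mform_mulE mcoeff_mform /mform mulr_suml.
apply: eq_bigr => u _; rewrite -mulrA; congr (_ * _); rewrite -/(mform _ _).
rewrite -/(comp_form _ _) -/(comp_form _ _).
have [->|u0] := eqVneq u 0%MM; first by rewrite mpolyX0 !mul1r.
have [i ui] : exists i, (0 < u i)%N.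
  apply/existsP; apply: contraNT u0; rewrite negb_exists => /forallP u0.
  by apply/eqP/mnmP => i; rewrite mnm0E; have := u0 i; case: (u i).
rewrite -(mnm_subK ui) mpolyXD -mulrA comp_form_mulX ?mul0r //.
by move: g0; rewrite /toric_map rmorphM /= => ->; rewrite mulr0.
Qed.

Lemma sum_lies_over u : (wdeg n u)%:Z = d ->
  (\sum_(t < 4 | leader D t) lies_over t u)%N = 1%N.
Proof.
move=> ud; have [i ui] := ex_support ud.
have Di : D (2 ^ i) by apply/vertexP; exists u.
have [r4 _ lr] := graph_ok_rep Dok (ltn_ord i) Di.
rewrite (bigD1 (Ordinal r4)) //= (lies_overE _ ud ui) eqxx big1 // => t /andP[_].
by rewrite -val_eqE /= (lies_overE _ ud ui) eq_sym => /negbTE ->.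
Qed.

Lemma ex_over : exists w : 'I_4 -> 'X_{1..4}, forall t : 'I_4, leader D t ->
  (wdeg n (w t))%:Z = d /\ (0 < w t t)%N.
Proof.
have [t|w wP] := @fin_all_exists 'I_4 (fun=> 'X_{1..4})
  (fun t u => leader D t -> (wdeg n u)%:Z = d /\ (0 < u t)%N); last by exists w.
have [/andP[/vertexP[u uP] _]|] := boolP (leader D t); first by exists u.
by exists 0%MM.
Qed.

(** Modulo m I_H every monomial of degree d equals the monomial chosen over its component, so p
    reduces to a combination of these whose coefficients are the component forms. *)
Lemma in_mI_comp_form p : homogeneous n d p ->
  (forall t : 'I_4, leader D t -> comp_form t p = 0) -> in_mI p.
Proof.
move=> hp p0; have [w wP] := ex_over.
suff : in_mI (p - \sum_(t < 4 | leader D t) comp_form t p *: 'X_[w t]).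
  by rewrite big1 ?subr0 // => t lt; rewrite p0 ?scale0r.
have -> : p - \sum_(t < 4 | leader D t) comp_form t p *: 'X_[w t] =
    \sum_(u <- msupp p) p@_u *:
      ('X_[u] - \sum_(t < 4 | leader D t) (lies_over t u)%:R *: 'X_[w t]).
  under [RHS]eq_bigr => u _ do rewrite scalerBr scaler_sumr.
  rewrite sumrB -mpolyE exchange_big /=; congr (_ - _).
  apply: eq_bigr => t _; rewrite /comp_form /mform scaler_suml.
  by apply: eq_big_seq => u /hp ->; rewrite eqxx scalerA.
apply: in_mI_sum => u up; apply: in_mIZ; have ud := hp _ up.
have [i ui] := ex_support ud.
have Di : D (2 ^ i) by apply/vertexP; exists u.
have [r4 ir lr] := graph_ok_rep Dok (ltn_ord i) Di.
rewrite (bigD1 (Ordinal r4)) //= (lies_overE _ ud ui) eqxx scale1r.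
rewrite big1 => [|t /andP[_]]; last first.
  rewrite -val_eqE /= (lies_overE _ ud ui) eq_sym => /negbTE ->.
  by rewrite scale0r.
have [_] := linked_joined (ltn_ord i) r4 ir; rewrite addr0.
have [wd wr] := wP (Ordinal r4) lr.
apply; rewrite ?inord_val //.
by rewrite (_ : inord _ = Ordinal r4) //; apply: val_inj; rewrite /= inordK.
Qed.

(** Syzygies of the generators come from [d2], whose entries have no constant term. *)
Lemma const_kernel (v : 'rV[S]_m) : v *m d1 = 0 -> forall i, (v 0 i)@_0%MM = 0.
Proof.
case/exact1 => u -> i; rewrite mxE raddf_sum big1 //= => j _.
by rewrite rmorphM /= min2 mulr0.
Qed.

Variable a : m.-tuple int.
Hypothesis gr1 : graded_map n a [tuple 0] d1.

Lemma homogeneous_gen i : homogeneous n (tnth a i) (gen i).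
Proof. by move: gr1 => g; have := g i 0; rewrite (tnth_nth 0) subr0. Qed.

Lemma comp_form_gen t i : tnth a i != d -> comp_form t (gen i) = 0.
Proof.
move=> ad; rewrite /comp_form /mform big1_seq // => u.
case/andP=> _ /homogeneous_gen ua; by rewrite ua (negbTE ad) mulr0.
Qed.

(** By minimality the generators of degree d form a basis of the degree d part of I_H / m I_H. The
    component forms identify this space with the vectors, indexed by the components, of coordinate
    sum zero. *)
Lemma count_generators : count_mem d a = betti1 D.
Proof.
pose J := [pred i : 'I_m | tnth a i == d].
pose T := [pred t : 'I_4 | leader D t].
have -> : count_mem d a = #|J|.
  by rewrite -sum1_count big_tuple -sum1_card; apply: eq_bigl.
have -> : betti1 D = #|T|.-1.
  rewrite /betti1 /ncomp -sum1_count -[iota 0 4]/(index_iota 0 4) big_mkord.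
  by rewrite sum1_card.
pose phi (p : S) : 'rV[K]_#|T| := \row_y comp_form (enum_val (A := T) y) p.
pose Phi : 'M[K]_(#|J|, #|T|) :=
  \matrix_(x, y) comp_form (enum_val (A := T) y) (gen (enum_val (A := J) x)).
pose o : 'M[K]_(#|T|, 1) := const_mx 1.
have rk_o : \rank o = (0 < #|T|)%N.
  case: posnP => [z0|z0].
    by apply/eqP; rewrite -leqn0 -[leqRHS]z0 rank_leq_row.
  apply/eqP; rewrite eqn_leq rank_leq_col lt0n mxrank_eq0 /=.
  apply/eqP => /matrixP/(_ (Ordinal z0) 0)/eqP; rewrite !mxE.
  by rewrite oner_eq0.
(* A relation between the rows gives a constant combination [l] of generators in m I_H, hence a
   syzygy [l - v]; its constant terms, which are those of [l], vanish. *)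
have free_Phi : row_free Phi.
  rewrite -kermx_eq0; apply/eqP/row_matrixP => i; rewrite row0.
  set x := row i _; have xM : x *m Phi = 0 by apply/sub_kermxP/row_sub.
  clearbody x.
  pose l : 'rV[S]_m := \sum_y (x 0 y)%:MP *: delta_mx 0 (enum_val (A := J) y).
  have lE : (l *m d1) 0 0 = \sum_y x 0 y *: gen (enum_val (A := J) y).
    rewrite mulmx_suml summxE; apply: eq_bigr => y _.
    by rewrite -scalemxAl -rowE !mxE mul_mpolyC.
  have [||v [v0 vl]] := @in_mI_comp_form ((l *m d1) 0 0).
  - rewrite lE => u; rewrite mcoeff_msupp raddf_sum /= => nz.
    apply/eqP; apply: contraNT nz => ud; rewrite big1 // => y _.
    have /eqP yd := enum_valP (A := J) y.
    by rewrite mcoeffZ (homogeneous_coef (@homogeneous_gen _)) ?mulr0 // yd.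
  - move=> t lt; rewrite lE linear_sum /=.
    have tT : t \in T by [].
    have /rowP/(_ (enum_rank_in tT t)) := xM; rewrite !mxE => xt.
    rewrite -[RHS]xt; apply: eq_bigr => y _.
    by rewrite linearZ mxE enum_rankK_in.
  have /const_kernel lv : (l - v) *m d1 = 0.
    rewrite mulmxBl; apply/rowP => j.
    by rewrite ord1 [LHS]mxE [in X in _ + X]mxE -vl subrr mxE.
  apply/rowP => y; rewrite [RHS]mxE; have := lv (enum_val (A := J) y).
  rewrite mxE [in X in _ + X]mxE mcoeffB v0 subr0 => <-.
  rewrite summxE raddf_sum (bigD1 y) //= big1 ?addr0 => [|z zy].
    by rewrite !mxE !eqxx mulr1 mcoeffC eqxx mulr1.
  rewrite !mxE eqxx (inj_eq enum_val_inj) eq_sym (negbTE zy).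
  by rewrite mulr0 mcoeff0.
(* Under the forms, a combination of generators keeps only the constant terms of its coefficients at
   the generators of degree d. *)
have phi_I p : toric_map n p = 0 -> (phi p <= Phi)%MS.
  case/exact0 => v ->.
  pose x : 'rV[K]_#|J| := \row_y (v 0 (enum_val (A := J) y))@_0%MM.
  suff -> : phi ((v *m d1) 0 0) = x *m Phi by exact: submxMl.
  apply/rowP => t; rewrite !mxE linear_sum /=.
  under [RHS]eq_bigr => y _ do rewrite !mxE.
  rewrite -(big_enum_val (A := J) (fun j =>
    (v 0 j)@_0%MM * comp_form (enum_val (A := T) t) (gen j))).
  rewrite [RHS]big_mkcond /=; apply: eq_bigr => j _.
  rewrite comp_form_mul ?toric_map_gen //; case: ifPn => // jd.
  by rewrite comp_form_gen // mulr0.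
have -> : #|J| = \rank (kermx o).
  rewrite -(eqP free_Phi); apply/eqmx_rank/andP; split.
    apply/sub_kermxP/matrixP => x y; rewrite !mxE.
    under eq_bigr => t _ do rewrite !mxE mulr1.
    rewrite -(big_enum_val (A := T)
      (fun t => comp_form t (gen (enum_val (A := J) x)))).
    rewrite exchange_big /=.
    rewrite -[RHS](mform_toric_map d (toric_map_gen (enum_val (A := J) x))).
    apply: eq_bigr => u _; rewrite -mulr_sumr; congr (_ * _).
    case: eqP => /= [ud|_]; last by rewrite big1.
    by rewrite -natr_sum sum_lies_over.
  apply/row_subP => i; set x := row i _.
  have xM : x *m o = 0 by apply/sub_kermxP/row_sub.
  clearbody x.
  have [w wP] := ex_over.
  have phiX t : phi 'X_[w (enum_val (A := T) t)] = delta_mx 0 t.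
    have [wd wt] := wP _ (enum_valP (A := T) t).
    apply/rowP => t'; rewrite !mxE /comp_form mformX wd eqxx /=.
    rewrite (lies_overE _ wd wt); congr (_ %:R); congr nat_of_bool.
    have /andP[_ /eqP ->] := enum_valP (A := T) t.
    by rewrite val_eqE (inj_eq enum_val_inj) eq_sym.
  (* A vector of sum zero combines differences of basis vectors, which are images of binomials in
     I_H. The row index [i] serves as an arbitrary base component. *)
  have -> : x = \sum_t x 0 t *:
      phi ('X_[w (enum_val (A := T) t)] - 'X_[w (enum_val (A := T) i)]).
    have phiB p r : phi (p - r) = phi p - phi r.
      by apply/rowP => t; rewrite !mxE linearB.
    under eq_bigr => t _ do rewrite phiB !phiX scalerBr.
    rewrite sumrB -row_sum_delta -scaler_suml.
    have -> : \sum_t x 0 t = (x *m o) 0 0.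
      by rewrite mxE; apply: eq_bigr => t _; rewrite mxE mulr1.
    by rewrite xM mxE scale0r subr0.
  apply: summx_sub => t _; apply: scalemx_sub; apply: phi_I.
  apply: toric_map_sub; apply/eqP; rewrite -eqz_nat.
  by rewrite (wP _ (enum_valP (A := T) t)).1 (wP _ (enum_valP (A := T) i)).1.
by rewrite mxrank_ker rk_o; case: #|T| => // k; rewrite subn1.
Qed.

End Degree.

(** A generator of degree 0 without constant term is zero, which gives a syzygy with entry 1,
    against minimality. *)
Lemma count_generators0 (a : m.-tuple int) :
  graded_map n a [tuple 0] d1 -> count_mem 0 a = 0%N.
Proof.
move=> gr1; apply/eqP; rewrite -leqn0 leqNgt -has_count has_pred1.
apply/negP => /tnthP[i ai].
have g0 : gen i = 0.
  apply/mpolyP => u; rewrite mcoeff0.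
  have [->|u0] := eqVneq u 0%MM; first exact: min1.
  apply: (homogeneous_coef (homogeneous_gen gr1 (i := i))); rewrite -ai.
  by have := mdeg_le_wdeg n_gt0 u; rewrite -mdeg_eq0 in u0; lia.
have i0 : (delta_mx 0 i : 'rV[S]_m) *m d1 = 0.
  by apply/rowP => j; rewrite -rowE ord1 !mxE.
have := const_kernel i0 i; rewrite mxE !eqxx mcoeff1 eqxx => /eqP.
by rewrite oner_eq0.
Qed.

End MinimalGenerators.

(** * Almost symmetric semigroups *)

Lemma int_in_ge0 (H : numSemigroup) x : int_in H x -> 0 <= x.
Proof. by case: x. Qed.

Section AlmostSymmetric.
Variables (H : numSemigroup) (n : 'I_4 -> nat).
Hypothesis gapsH : gaps H <> fset0.
Hypothesis genH : minimally_generated H n.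

Local Notation F := ((frobenius H)%:Z).

Lemma int_inP e : int_in H e <-> exists u, (wdeg n u)%:Z = e.
Proof.
case: e => [x|x]; last by split=> // -[u].
rewrite /= genH.1; split=> [[c ->]|[u [<-]]].
  exists [multinom c i | i < 4]; congr Posz; apply: eq_big => i; rewrite ?inE //.
  by rewrite mnmE.
by exists u; apply: eq_bigl => i; rewrite inE.
Qed.

Lemma generator_gt0 i : (0 < n i)%N.
Proof.
rewrite lt0n; apply/eqP => ni0; apply: (genH.2 [set~ i]).
  by rewrite properT; apply/eqP => /setP/(_ i); rewrite !inE eqxx.
move=> x; rewrite genH.1; split=> -[c ->].
  exists c; rewrite (bigD1 i) ?inE //= ni0 muln0 add0n.
  by apply: eq_bigl => j; rewrite !inE.
exists (fun j => if j == i then 0 else c j)%N.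
rewrite [RHS](bigD1 i) ?inE //= eqxx mul0n add0n.
by apply: eq_big => j; rewrite !inE //= => /negbTE ->.
Qed.

Lemma int_inD x y : int_in H x -> int_in H y -> int_in H (x + y).
Proof.
move=> /int_inP[u <-] /int_inP[v <-]; apply/int_inP.
by exists (u + v)%MM; rewrite wdegD.
Qed.

Lemma int_in_gen i : int_in H (n i)%:Z.
Proof. by apply/int_inP; exists U_(i)%MM; rewrite wdegU. Qed.

Lemma frobenius_gap : frobenius H \in gaps H.
Proof.
have : enum_fset (gaps H) != [::].
  apply: contra_notN gapsH => /eqP s0; apply/fsetP => x.
  by rewrite [LHS]/(x \in enum_fset _) s0 inE.
rewrite -[_ \in gaps H]/(_ \in enum_fset (gaps H)) /frobenius.
elim: (enum_fset (gaps H)) => // x [|y s] IHs _.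
  by rewrite big_seq1 mem_seq1.
rewrite big_cons inE; case: leqP => _; last by rewrite eqxx.
by rewrite IHs ?orbT.
Qed.

Lemma gap_le_frobenius x : x \in gaps H -> (x <= frobenius H)%N.
Proof.
move=> xH; rewrite /frobenius.
by rewrite (@leq_bigmax_seq _ _ xpredT (fun y : nat => y)).
Qed.

Lemma frobeniusN : ~~ int_in H F.
Proof. by rewrite /= [_ \in H]unfold_in negbK frobenius_gap. Qed.

Lemma int_in_gt_frobenius x : F < x -> int_in H x.
Proof.
case: x => [x|//] /=; rewrite ltz_nat unfold_in => Fx; apply: contraL Fx.
by rewrite -leqNgt; apply: gap_le_frobenius.
Qed.

Lemma frobenius_PF : F \in PF H n.
Proof.
rewrite mem_PF /pseudo_frobenius frobeniusN; apply/forallP => i.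
by apply: int_in_gt_frobenius; have := generator_gt0 i; lia.
Qed.

(** If F - f were in H, it would be nonzero and so contain a summand n_i; then F would be the sum of
    f + n_i and an element of H. *)
Lemma PF_frobenius_sub f : f \in PF H n -> f != F -> ~~ int_in H (F - f).
Proof.
rewrite mem_PF => /andP[_ /forallP fn] fF; apply/negP => /int_inP[u uF].
have [i ui] : exists i, (0 < u i)%N.
  by apply: (ex_support _ uF); rewrite subr_eq0 eq_sym.
have := wdegD n U_(i) (u - U_(i)); rewrite mnm_subK // wdegU => uE.
have : int_in H (f + (n i)%:Z + (wdeg n (u - U_(i)))%:Z).
  by apply: int_inD (fn i) _; apply/int_inP; exists (u - U_(i))%MM.
suff -> : f + (n i)%:Z + (wdeg n (u - U_(i)))%:Z = F by apply/negP/frobeniusN.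
by lia.
Qed.

Hypothesis symH : almost_symmetric H n.

Lemma card_PF' : #|` PF' H n| = (sg_type H n).-1.
Proof. by rewrite /sg_type (cardfsD1 F (PF H n)) frobenius_PF. Qed.

(* The count behind the criterion: of each pair {x, F - x} in [0, F] at least
   one member is a gap, so exactly 2 g - (F + 1) = t - 1 numbers x have both x
   and F - x as gaps; PF'(H) is contained in this set and has t - 1 elements. *)
Lemma mem_PF' x : (x \in PF' H n) = ~~ int_in H x && ~~ int_in H (F - x).
Proof.
pose P y := y \in gaps H; pose P' y := P (frobenius H - y)%N.
pose r := iota 0 (frobenius H).+1.
have rP : {in r, forall y, (y <= frobenius H)%N} by move=> y; rewrite mem_iota.
have countP : count P r = #|` gaps H|.
  rewrite -size_filter; apply/perm_size/uniq_perm.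
  - by rewrite filter_uniq ?iota_uniq.
  - exact: fset_uniq.
  move=> y; rewrite mem_filter mem_iota add0n ltnS /=.
  by apply/andP/idP => [[]|yH] //; split=> //; apply: gap_le_frobenius.
have countP' : count P' r = #|` gaps H|.
  rewrite -countP -!sum1_count -[r]/(index_iota 0 (frobenius H).+1).
  by rewrite [RHS]big_nat_rev.
have countU : count (predU P P') r = (frobenius H).+1.
  rewrite -[RHS](size_iota 0) -count_predT; apply: eq_in_count => y /rP yF /=.
  apply: contraTT frobenius_gap; rewrite negb_or => /andP[yG FyG].
  have := @int_inD (Posz y) (Posz (frobenius H - y)) yG FyG.
  by rewrite -PoszD subnKC.
pose L := [seq Posz y | y <- r & P y && P' y].
have szL : size L = #|` PF' H n|.
  rewrite size_map size_filter card_PF'.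
  have := count_predUI P P' r; rewrite countU countP countP'.
  rewrite (eq_count (a2 := predI P P')) //; have := symH.
  rewrite /almost_symmetric; lia.
have memL y : (y \in L) = ~~ int_in H y && ~~ int_in H (F - y).
  apply/mapP/andP => [[z]|[yH Fy]].
    rewrite mem_filter => /andP[/andP[zH FzH] /rP zF] ->.
    split; first by rewrite /= [_ \in H]unfold_in negbK.
    by rewrite subzn //= [_ \in H]unfold_in negbK.
  have y0 : 0 <= y.
    by case: leP => // y0; case/negP: Fy; apply: int_in_gt_frobenius; lia.
  have yF : y <= F.
    by rewrite leNgt; apply: contra yH; apply: int_in_gt_frobenius.
  case: y y0 yF yH Fy => // y _; rewrite lez_nat => yF yH.
  rewrite subzn // => Fy; exists y => //.
  rewrite mem_filter mem_iota ltnS yF !andbT.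
  move: yH Fy; rewrite /= ![_ \in H]unfold_in !negbK /P' /P => yH Fy.
  by apply/andP; split.
have sub : {subset enum_fset (PF' H n) <= L}.
  move=> y; rewrite -[_ \in enum_fset _]/(y \in PF' H n) in_fsetD1 memL.
  case/andP=> yF yP.
  rewrite PF_frobenius_sub // andbT.
  by move: yP; rewrite mem_PF => /andP[].
have [_ eqL] := uniq_min_size (fset_uniq _) sub (eq_leq szL).
by rewrite -memL -eqL.
Qed.

Lemma PF'_add f i : f \in PF' H n -> int_in H (f + (n i)%:Z).
Proof. by rewrite in_fsetD1 mem_PF => /and3P[_ _ /forallP]. Qed.

(** * Duality between the degrees d and F + N - d *)

Section DualDegree.

Local Notation N := ((\sum_(i < 4) n i)%N%:Z).
Local Notation faces d := (face_seq n (int_in H) d).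
Local Notation D d := (nth false (faces d)).
Local Notation sigma d := (F + N - d).

Lemma size_faces d : size (faces d) = 16%N.
Proof. exact: size_mkseq. Qed.

Lemma mask_weight15 : mask_weight n 15 = (\sum_(i < 4) n i)%N.
Proof. by rewrite -(@mask_weight_compl n 0) // mask_weight0 addn0. Qed.

Lemma faces_monotone d : faces d \in monotone_seqs 4.
Proof.
apply: mem_monotone_seqs => [|k i k16 i4 ki]; first exact: size_faces.
have ki16 : (k - 2 ^ i < 16)%N by apply: leq_ltn_trans (leq_subr _ _) k16.
rewrite !face_seqE // (@mask_weight_sub n k (Ordinal i4)) // => dk.
have -> : d - (mask_weight n (k - 2 ^ i))%:Z = 
    d - (mask_weight n (k - 2 ^ i) + n (Ordinal i4))%:Z + (n (Ordinal i4))%:Z.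
  by lia.
exact: int_inD dk (int_in_gen _).
Qed.

Lemma dual_face d k : (k < 16)%N ->
  D (sigma d) (15 - k) = int_in H (F - (d - (mask_weight n k)%:Z)).
Proof.
move=> k16; rewrite face_seqE; last by rewrite ltnS leq_subr.
by congr (int_in H _); have := mask_weight_compl n k16; lia.
Qed.

Lemma missingE d k : (k < 16)%N ->
  missing (D d) (D (sigma d)) k = (d - (mask_weight n k)%:Z \in PF' H n).
Proof. by move=> k16; rewrite mem_PF' /missing dual_face // face_seqE. Qed.

Lemma faces_compatible d : compatible (D d) (D (sigma d)).
Proof.
apply/allP => k; rewrite mem_iota => k16; apply/andP; split.
  rewrite dual_face // face_seqE //; apply/negP => /andP[dk Fdk].
  by have := int_inD dk Fdk; rewrite addrC subrK; apply/negP/frobeniusN.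
rewrite missingE //; apply/implyP => fP; apply/allP => i; rewrite mem_iota => i4.
apply/implyP => ki.
have ki16 : (k - 2 ^ i < 16)%N by apply: leq_ltn_trans (leq_subr _ _) k16.
rewrite face_seqE //; have -> : d - (mask_weight n (k - 2 ^ i))%:Z =
    d - (mask_weight n k)%:Z + (n (Ordinal i4))%:Z.
  by have /= := @mask_weight_sub n k (Ordinal i4) k16 ki; lia.
exact: PF'_add.
Qed.

Lemma faces_betti_ok d : betti_ok (D d) (D (sigma d)).
Proof.
apply: betti_okT; rewrite ?size_faces ?faces_monotone ?faces_compatible //.
by have := faces_compatible (sigma d); rewrite subKr.
Qed.

Lemma only_emptyE d : only_empty (D d) = (d == 0).
Proof.
rewrite /only_empty face_seqE // mask_weight0 subr0; apply/andP/eqP => [[]|->].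
  move=> /int_inP[u ud] /hasPn no; apply/eqP; apply: contraT => d0.
  have [i ui] := ex_support d0 ud.
  have := no i; rewrite mem_iota ltn_ord => /(_ isT)/negP[].
  by apply/(vertexP d int_inP); exists u.
split=> //; first by apply/int_inP; exists 0%MM; rewrite wdeg0.
apply/hasPn => i; rewrite mem_iota => i4.
rewrite face_seqE; last exact: (lt_pow4 (Ordinal i4)).
rewrite (mask_weight1 n (Ordinal i4)) sub0r; apply/negP => /int_in_ge0.
by have := generator_gt0 (Ordinal i4); lia.
Qed.

(** N - n_i is the weight of the complement of {i}, and PF' has no repetitions, so each i
    contributes 1 exactly when that complement is missing. *)
Lemma count_kos1 (d : int) :
  count_mem d [seq f + N - (n i)%:Z | f <- enum_fset (PF' H n), i <- enum 'I_4]
    = missing3 (D d) (D (sigma d)).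
Proof.
rewrite -sum1_count big_mkcond big_allpairs_dep exchange_big /= big_enum /=.
rewrite missing3E; apply: eq_bigr => i _.
rewrite missingE; last by rewrite ltnS leq_subr.
have := mask_weight_compl n (lt_pow4 i); rewrite mask_weight1 => wE.
have -> : d - (mask_weight n (15 - 2 ^ i))%:Z = d + (n i)%:Z - N by lia.
rewrite -big_mkcond sum1_count /= -(count_uniq_mem _ (fset_uniq _)).
by apply: eq_count => f /=; rewrite subr_eq [RHS]eq_sym subr_eq eq_sym.
Qed.

Lemma count_kos2 (d : int) :
  count_mem d [seq f + (n ij.1)%:Z + (n ij.2)%:Z
    | f <- enum_fset (PF' H n),
      ij : 'I_4 * 'I_4 <- enum [set ij : 'I_4 * 'I_4 | (ij.1 < ij.2)%N]]
    = missing2 (D d) (D (sigma d)).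
Proof.
rewrite -sum1_count big_mkcond big_allpairs_dep exchange_big /= big_enum /=.
rewrite missing2E; apply: eq_big => [ij|[i j]]; rewrite !inE //= => ij.
have {}ij : i != j :> nat by rewrite neq_ltn ij.
rewrite missingE ?lt_pow4D // mask_weight2 //.
rewrite -big_mkcond sum1_count /= -(count_uniq_mem _ (fset_uniq _)).
by apply: eq_count => f /=; rewrite -addrA -PoszD [RHS]eq_sym subr_eq eq_sym.
Qed.

Section Betti.
Variables (K : fieldType) (p q m : nat).
Variables (c : p.-tuple int) (b : q.-tuple int) (a : m.-tuple int).
Variables (d3 : 'M[{mpoly K[4]}]_(p, q)) (d2 : 'M[{mpoly K[4]}]_(q, m))
  (d1 : 'M[{mpoly K[4]}]_(m, 1)).
Hypothesis res : graded_min_free_res n c b a d3 d2 d1.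
Hypothesis cE : perm_eq c [seq f + N | f <- enum_fset (PF H n)].

Lemma count_a (d : int) : count_mem d a = betti1 (D d).
Proof.
have Dok := graph_okT (faces_monotone d).
move: (min1 res) (min2 res) (exact1 res) (exact0 res) (gr1 res) => e3 e2 e1 e0 g1.
(* In degree 0 the monomial 1 lies over no component, so this degree is treated apart. *)
have [d0|d0] := eqVneq d 0; last first.
  by rewrite (count_generators e2 e1 e0 int_inP d0 Dok g1).
rewrite d0 (count_generators0 generator_gt0 e3 e2 e1 g1).
have := only_emptyE 0; rewrite eqxx => /andP[_ /hasPn no].
rewrite /betti1 /ncomp; apply/esym/eqP; rewrite -leqn0 -[leqRHS]/(0.-1)%N.
have -> // : count (leader (D 0)) (iota 0 4) = 0%N.
apply/eqP; rewrite -leqn0 leqNgt -has_count.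
by apply/hasPn => i /no; rewrite /leader => /negbTE ->.
Qed.

Lemma count_c (d : int) : count_mem d c = betti3 (D d) (D (sigma d)).
Proof.
rewrite (permP cE) count_map /betti3 missingE // mask_weight15 only_emptyE.
rewrite (eq_count (a2 := pred1 (d - N))); last by move=> f /=; apply/eqP/eqP; lia.
rewrite count_uniq_mem ?fset_uniq // -[_ \in enum_fset _]/(_ \in PF H n).
have -> : (sigma d == 0) = (d - N == F) by apply/eqP/eqP; lia.
by rewrite in_fsetD1; case: eqP => [->|_]; rewrite ?frobenius_PF ?addn0.
Qed.

(** The other multiplicities being known, the Euler characteristic determines this one. *)
Lemma count_b (d : int) : count_mem d b = betti2 (D d) (D (sigma d)).
Proof.
have /and4P[le_par _ _ _] := faces_betti_ok d.
have := euler_char generator_gt0 res d int_inP.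
have -> : \sum_(k < 16) (-1) ^+ mask_size k *
    (int_in H (d - (mask_weight n k)%:Z))%:R
   = (faces_of_parity (D d) false)%:R - (faces_of_parity (D d) true)%:R :> int.
  by rewrite -sign_sum_faces; apply: eq_bigr => k _; rewrite face_seqE.
rewrite count_a count_c /betti2 -(only_emptyE d) => e.
by move: e le_par; rewrite /betti2; lia.
Qed.

End Betti.
End DualDegree.
End AlmostSymmetric.

(** * Ordering the shifts *)

Lemma perm_cat_sub (T : eqType) (s s' : seq T) :
  (forall x, count_mem x s <= count_mem x s')%N -> exists r, perm_eq s' (s ++ r).
Proof.
move=> /count_subseqP[s1 /perm_to_subseq[r s'r] ss1].
by exists r; rewrite (perm_trans s'r) // perm_cat2r perm_sym.
Qed.

Theorem proposition6p2 (K : fieldType) (H : numSemigroup) (n : 'I_4 -> nat)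
    (m : nat) (c : (sg_type H n).-tuple int)
    (b : (m + sg_type H n - 1).-tuple int) (a : m.-tuple int)
    (d3 : 'M[{mpoly K[4]}]_(sg_type H n, m + sg_type H n - 1))
    (d2 : 'M[{mpoly K[4]}]_(m + sg_type H n - 1, m))
    (d1 : 'M[{mpoly K[4]}]_(m, 1)) :
  let t := sg_type H n in
  let N := (\sum_(i < 4) n i)%N%:Z in
  let F := (frobenius H)%:Z in
  let m0 := (3 * (t - 1))%N in
  gaps H <> fset0 ->
  minimally_generated H n ->
  almost_symmetric H n ->
  perm_eq c [seq f + N | f <- enum_fset (PF H n)] ->
  graded_min_free_res n c b a d3 d2 d1 ->
  exists s : nat, m = (m0 + s)%N /\
  exists a' b' : seq int,
    [/\ perm_eq a' a,
        perm_eq b' b,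
        perm_eq (take m0 a' ++ [seq F + N - x | x <- take m0 a'])
          [seq f + (n ij.1)%:Z + (n ij.2)%:Z
             | f <- enum_fset (PF' H n),
               ij : 'I_4 * 'I_4 <- enum [set ij : 'I_4 * 'I_4 | (ij.1 < ij.2)%N]],
        perm_eq (take (m0 + t - 1) b')
          [seq f + N - (n i)%:Z | f <- enum_fset (PF' H n), i <- enum 'I_4]
      & forall j, (j < s)%N ->
          nth 0 a' (m0 + j) = F + N - nth 0 b' (m0 + t - 1 + j)].
Proof.
move=> t N F m0 gapsH genH symH cE res.
(* Hence the subtraction in the length of [b] is not truncated. *)
have t_gt0 : (0 < t)%N.
  by rewrite /t /sg_type (cardfsD1 F (PF H n)) (frobenius_PF gapsH genH).
pose sigma (x : int) : int := F + N - x.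
have sigmaK : involutive sigma by move=> x; rewrite /sigma subKr.
pose D x := nth false (face_seq n (int_in H) x).
have ok x : betti_ok (D x) (D (sigma x)) := faces_betti_ok gapsH genH symH x.
have aE x : count_mem x a = betti1 (D x) := count_a genH res x.
have bE x : count_mem x b = betti2 (D x) (D (sigma x)) :=
  count_b gapsH genH symH res cE x.
set kos1 := [seq f + N - (n i)%:Z | f <- enum_fset (PF' H n), i <- enum 'I_4].
set kos2 := [seq _ | f <- _, ij <- _].
have k1E x : count_mem x kos1 = missing3 (D x) (D (sigma x)) :=
  count_kos1 gapsH genH symH x.
have k2E x : count_mem x kos2 = missing2 (D x) (D (sigma x)) :=
  count_kos2 gapsH genH symH x.
have sz_kos1 : size kos1 = (m0 + t - 1)%N.
  rewrite size_allpairs -cardE card_ord -[size _]/(#|` PF' H n|).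
  by rewrite (card_PF' gapsH genH) /m0 -/t; lia.
(* [b1] collects the b_j that are not of the form f + N - n_i; they are paired with the last s of
   the a_i. *)
have [b1 b1E] : exists b1, perm_eq b (kos1 ++ b1).
  by apply: perm_cat_sub => x; rewrite bE k1E; have /and4P[] := ok x.
have count_b1 x : count_mem x b1 =
    (betti2 (D x) (D (sigma x)) - missing3 (D x) (D (sigma x)))%N.
  by have := permP b1E (pred1 x); rewrite count_cat bE k1E => ->; rewrite addKn.
have count_sigma s x : count_mem x (map sigma s) = count_mem (sigma x) s.
  rewrite count_map; apply: eq_count => y /=.
  by rewrite -(inj_eq (can_inj sigmaK)) sigmaK.
have [a0 a0E] : exists a0, perm_eq a (map sigma b1 ++ a0).
  apply: perm_cat_sub => x; rewrite count_sigma count_b1 aE leq_subLR.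
  by have /and4P[_ _] := ok (sigma x); rewrite -/(sigma _) sigmaK.
(* Compare lengths: m + t - 1 on one side, 4 (t - 1) plus the size of [b1] on the other. *)
have sz_b1 : m = (m0 + size b1)%N.
  have := perm_size b1E; rewrite size_cat sz_kos1 size_tuple -/t /m0.
  by move: t_gt0; clear; move: t (size b1) => {}t s; lia.
have sz_a0 : size a0 = m0.
  apply/eqP; rewrite -(eqn_add2r (size b1)) -sz_b1 addnC.
  by have := perm_size a0E; rewrite size_cat size_map size_tuple => <-.
have take_a : take m0 (a0 ++ map sigma b1) = a0 by rewrite take_size_cat.
exists (size b1); split=> //; exists (a0 ++ map sigma b1), (kos1 ++ b1); split.
- by rewrite perm_sym (perm_trans a0E) // perm_catC.
- by rewrite perm_sym.
(* The multiplicities of x and [sigma x] in [a0] must add up to that of x in [kos2]. This is the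
   last clause of [betti_ok]; the inequalities in degrees x and [sigma x] make the subtractions
   exact. *)
- rewrite take_a; apply/allP => x _ /=.
  rewrite count_cat count_sigma k2E; apply/eqP.
  have := permP a0E (pred1 x); have := permP a0E (pred1 (sigma x)).
  rewrite !count_cat !count_sigma !count_b1 !aE !sigmaK.
  have := ok (sigma x); rewrite sigmaK => /and4P[_ + + _].
  have /and4P[_ + + /eqP] := ok x.
  move: (betti2 _ _) (betti2 _ _) (missing3 _ _) (missing3 _ _) (missing2 _ _).
  move: (betti1 _) (betti1 _) (count_mem x a0) (count_mem _ a0); clear.
  by move=> *; lia.
- by rewrite take_size_cat // -sz_kos1.
- move=> j jb; rewrite !nth_cat sz_a0 sz_kos1 !ltnNge !leq_addr /= !addKn.
  by rewrite (nth_map 0).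
Qed.
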